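(* Let $(X,d_X,\odot,0_X)$ be an editable space. For any two $X$-valued dendrograms $T$ and $T'$ the set $\mathrm{Mapp}(T,T')$ is finite, and $$d_E(T,T')=\inf\{cost(\gamma)\mid \gamma\in\Gamma(T,T')\}=\min\{cost(M)\mid M\in \mathrm{Mapp}(T,T')\},$$ where $\Gamma(T,T')$ is the set of all finite edit paths from $T$ to $T'$. Moreover $d_E$ is a well defined pseudo-metric between $X$-valued dendrograms.
   Context: **Editable spaces.** An editable space is a set $X$ with a metric $d_X$, an operation $\odot$ and an element $0_X$ such that: (P1) $(X,d_X)$ is a metric space; (P2) $(X,\odot,0_X)$ is a commutative monoid; (P3) $d_X(0_X,x\odot y)=d_X(0_X,x)+d_X(0_X,y)$ for all $x,y$; (P4) $d_X(x,y)=d_X(z\odot x,z\odot y)=d_X(x\odot z,y\odot z)$ for all $x,y,z$. **Dendrograms.** A tree structure $T$ is a finite connected rooted acyclic graph $(V_T,E_T)$ with root $r_T$. The relation child $<$ parent generates a partial order on $V_T$. Each edge is written $(a,b)$ with $a<b$ ($b$ the parent of $a$) and is identified with its lower vertex $a$, so $E_T\cong V_T\setminus\{r_T\}$. Leaves are vertices with no children. A ''degree $2$ vertex'' is a non-root vertex with exactly one child. An ($X$-valued) dendrogram is a tree structure $T$ with a weight function $\varphi_T:E_T\to X\setminus\{0_X\}$. Dendrograms are considered up to isomorphism of rooted trees preserving weights. **Edits and costs.** - Shrinking an edge: replace its weight $x$ by another element $y\in X\setminus\{0_X\}$; cost $d_X(x,y)$. - Deleting an edge $(v_1,v_2)$ of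 weight $x$: remove $v_1$, its children becoming children of $v_2$ (keeping their weights); cost $d_X(x,0_X)$. Its inverse is the insertion of an edge of weight $x\in X\setminus\{0_X\}$ at a vertex $v$ (a new child of $v$ is created and any, possibly empty, subset of the children of $v$ becomes the set of its children); cost $d_X(x,0_X)$. - Ghosting a degree $2$ vertex $v$: remove $v$ and join its two adjacent edges, of weights $x,y$, into one edge of weight $x\odot y$; cost $0$. Its inverse is the splitting of an edge (of weight $x\odot y$ into two consecutive edges of weights $x,y\in X\setminus\{0_X\}$); cost $0$. A finite edit path from $T$ to $T'$ is a finite composition of edits transforming $T$ into (a dendrogram isomorphic to) $T'$; its cost is the sum of the costs of its edits. The edit distance is $d_E(T,T')=\inf_{\gamma\in\Gamma(T,T')}cost(\gamma)$. **Mappings.** Let $\mathfrak D,\mathfrak G$ be two symbols (''deletion'', ''ghosting''). A mapping between $T$ and $T'$ is a set $M\subset (E_T\cup\{\mathfrak D,\mathfrak G\})\times(E_{T'}\cup\{\mathfrak D,\mathfrak G\})$, containing no pair in $\{\mathfrak D,\mathfrak G\}\times\{\mathfrak D,\mathfrak G\}$, such that: (M1)-(M2) every element of $E_T$ is the first component of exactly one pair of $M$, and every element of $E_{T'}$ is the second component of exactly one pair of $M$; (M3) for $(a,b),(c,d)\in M\cap(V_T\times V_{T'})$: $a>c$ if and only if $b>d$; (M4) if $(a,\mathfrak G)\in M$ then, after applying all deletions of the $v$ with $(v,\mathfrak D)\in M$, the vertex $a$ is a degree $2$ vertex; analogously in $T'$ for $(\mathfrak G,a)\in M$. $\mathrm{Mapp}(T,T')$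 is the set of all mappings. **Cost of a mapping.** Given $M$, delete from $T$ all $v$ with $(v,\mathfrak D)\in M$ and then ghost all $v$ with $(v,\mathfrak G)\in M$, obtaining $T_M$; similarly delete from $T'$ all $w$ with $(\mathfrak D,w)\in M$ and then ghost all $w$ with $(\mathfrak G,w)\in M$, obtaining $T'_M$. The remaining pairs $(v,w)\in M\cap(E_T\times E_{T'})$ give an isomorphism of tree structures $T_M\cong T'_M$, and each edge $v$ of $T_M$ is shrunk to the weight of $w$ in $T'_M$. Then $$cost(M)=\sum_{(v,\mathfrak D)\in M}d_X(\varphi_T(v),0_X)+\sum_{(\mathfrak D,w)\in M}d_X(\varphi_{T'}(w),0_X)+\sum_{(v,w)\in M\cap(E_T\times E_{T'})}d_X(\varphi_{T_M}(v),\varphi_{T'_M}(w)).$$ *)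

(* Defs.v *)
From HB Require Import structures.
From mathcomp Require Import all_boot all_order all_algebra.
From mathcomp Require Import all_classical all_reals metric_structure.
Set Implicit Arguments.
Unset Strict Implicit.
Unset Printing Implicit Defensive.
Import Order.TTheory GRing.Theory Num.Theory.
Local Open Scope classical_set_scope.
Local Open Scope ring_scope.

Record editableSpace (R : realType) := EditableSpace {
  point :> metricType R ;
  ezero : point ;
  eop : Monoid.com_law ezero ;
  editD : forall x y : point,
    mdist ezero (eop x y) = mdist ezero x + mdist ezero y ;
  editI : forall x y z : point,
    mdist x y = mdist (eop z x) (eop z y) /\
    mdist x y = mdist (eop x z) (eop y z) }.

Arguments ezero {R e}.
Arguments eop {R e}.

(* An edge is identified with its lower vertex, so the vertices of a tree with
   edge type E are [option E], [None] being the root.  [parent e] is the upper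
   vertex of the edge [e]; it is the parent of the vertex [Some e]. *)
Definition child (E : finType) (parent : E -> option E) : rel (option E) :=
  fun a b => if a is Some e then parent e == b else false.

(* Since every non-root vertex has exactly one parent, the condition that the
   root be reachable from all vertices amounts to the underlying graph being
   connected and acyclic. *)
Record dendrogram (R : realType) (X : editableSpace R) := Dendrogram {
  edge : finType ;
  parent : edge -> option edge ;
  weight : edge -> X ;
  to_root : forall a : option edge, connect (child parent) a None ;
  weight_neq0 : forall e : edge, weight e != ezero }.

Arguments parent {R X d} e.
Arguments weight {R X d} e.

Section Dendrograms.
Context {R : realType} {X : editableSpace R}.
Local Notation dendrogram := (dendrogram X).

Definition below (T : dendrogram) (a b : option (edge T)) : bool :=
  (a != b) && connect (child (@parent R X T)) a b.

(* A tree obtained by editing a tree with edge type E keeps E as its ambient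
   type; only the edges in [live] are still present, and the values of [up] and
   [wt] at the other edges are meaningless. *)
Record wtree (E : finType) := WTree {
  live : {set E} ;
  up : E -> option E ;
  wt : E -> X }.

Definition whole (T : dendrogram) : wtree (edge T) :=
  WTree [set: edge T] parent weight.

Definition shrink (E : finType) (t : wtree E) (e : E) (y : X) : wtree E :=
  WTree (live t) (up t) (fun u => if u == e then y else wt t u).

Definition delete (E : finType) (t : wtree E) (e : E) : wtree E :=
  WTree (live t :\ e)
        (fun u => if up t u == Some e then up t e else up t u)
        (wt t).

Definition degree2 (E : finType) (t : wtree E) (e : E) : bool :=
  (e \in live t) && (#|[set u in live t | up t u == Some e]| == 1)%N.

(* The merged edge keeps the name of the lower of the two edges it is made of. *)
Definition ghost (E : finType) (t : wtree E) (e : E) : wtree E :=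
  WTree (live t :\ e)
        (fun u => if up t u == Some e then up t e else up t u)
        (fun u => if up t u == Some e then eop (wt t u) (wt t e) else wt t u).

(* Isomorphism of rooted trees preserving weights. *)
Definition iso (T : dendrogram) (E : finType) (t : wtree E) : Prop :=
  exists f : edge T -> E,
    [/\ injective f, [set f e | e in edge T]%SET = live t,
        forall e, up t (f e) = omap f (parent e) &
        forall e, wt t (f e) = weight e].

Definition dendro_iso (T T' : dendrogram) : Prop := iso T (whole T').

(* Insertions and splittings are the inverses of deletions and ghostings. *)
Inductive edit (T T' : dendrogram) : Type :=
| Shrink (e : edge T) (y : X) of
    y != ezero & iso T' (shrink (whole T) e y)
| Delete (e : edge T) of iso T' (delete (whole T) e)
| Insert (e : edge T') of iso T (delete (whole T') e)
| Ghost (e : edge T) of degree2 (whole T) e & iso T' (ghost (whole T) e)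
| Split (e : edge T') of degree2 (whole T') e & iso T (ghost (whole T') e).

Definition edit_cost (T T' : dendrogram) (s : edit T T') : R :=
  match s with
  | Shrink e y _ _ => mdist (weight e) y
  | Delete e _ => mdist (weight e) ezero
  | Insert e _ => mdist (weight e) ezero
  | Ghost _ _ _ => 0
  | Split _ _ _ => 0
  end.

Inductive edit_path : dendrogram -> dendrogram -> Type :=
| Stop (T T' : dendrogram) of dendro_iso T T' : edit_path T T'
| Step (T T1 T' : dendrogram) of edit T T1 & edit_path T1 T' : edit_path T T'.

Fixpoint path_cost (T T' : dendrogram) (g : edit_path T T') : R :=
  match g with
  | Stop _ _ _ => 0
  | Step _ _ _ s g' => edit_cost s + path_cost g'
  end.

Definition path_costs (T T' : dendrogram) : set R :=
  [set c | exists g : edit_path T T', path_cost g = c].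

Definition edit_dist (T T' : dendrogram) : R := inf (path_costs T T').

End Dendrograms.

Variant symb := Deletion | Ghosting.

Definition symb_to_bool (s : symb) := if s is Deletion then true else false.
Definition symb_of_bool (b : bool) := if b then Deletion else Ghosting.
Lemma symb_to_boolK : cancel symb_to_bool symb_of_bool. Proof. by case. Qed.
HB.instance Definition _ := Finite.copy symb (can_type symb_to_boolK).

Section Mappings.
Context {R : realType} {X : editableSpace R}.
Local Notation dendrogram := (dendrogram X).

(* [inl] is an edge, [inr] one of the two symbols. *)
Definition prepairs (T T' : dendrogram) : finType :=
  ((edge T + symb) * (edge T' + symb))%type.

Section OneMapping.
Context {T T' : dendrogram} (M : {set prepairs T T'}).

Definition deletedl : {set edge T} :=
  [set v | (inl v, inr Deletion) \in M]%SET.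
Definition ghostedl : {set edge T} :=
  [set v | (inl v, inr Ghosting) \in M]%SET.
Definition deletedr : {set edge T'} :=
  [set w | (inr Deletion, inl w) \in M]%SET.
Definition ghostedr : {set edge T'} :=
  [set w | (inr Ghosting, inl w) \in M]%SET.
Definition coupled : {set edge T * edge T'} :=
  [set p | (inl p.1, inl p.2) \in M]%SET.

Definition delete_all (E : finType) (t : wtree (X := X) E) (D : {set E}) :=
  foldl (@delete R X E) t (enum D).
Definition ghost_all (E : finType) (t : wtree (X := X) E) (G : {set E}) :=
  foldl (@ghost R X E) t (enum G).

Definition prunedl : wtree (edge T) := delete_all (whole T) deletedl.
Definition prunedr : wtree (edge T') := delete_all (whole T') deletedr.

Record mapping : Prop := Mapping {
  map_nosymb : forall s s' : symb, (inr s, inr s') \notin M ;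
  map_uniql : forall v : edge T,
    exists! q : edge T' + symb, (inl v, q) \in M ;
  map_uniqr : forall w : edge T',
    exists! q : edge T + symb, (q, inl w) \in M ;
  map_order : forall (a c : edge T) (b d : edge T'),
    (inl a, inl b) \in M -> (inl c, inl d) \in M ->
    (below (Some c) (Some a) <-> below (Some d) (Some b)) ;
  map_ghostl : forall a : edge T,
    (inl a, inr Ghosting) \in M -> degree2 prunedl a ;
  map_ghostr : forall b : edge T',
    (inr Ghosting, inl b) \in M -> degree2 prunedr b }.

(* The trees T_M and T'_M. *)
Definition reducedl : wtree (edge T) := ghost_all prunedl ghostedl.
Definition reducedr : wtree (edge T') := ghost_all prunedr ghostedr.

Definition map_cost : R :=
  \sum_(v in deletedl) mdist (weight v) ezero
  + \sum_(w in deletedr) mdist (weight w) ezero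
  + \sum_(p in coupled) mdist (wt reducedl p.1) (wt reducedr p.2).

End OneMapping.

Definition Mapp (T T' : dendrogram) : set {set prepairs T T'} :=
  [set M | mapping M].

End Mappings.

Arguments Mapp {R X} T T' _.

(* Main.v *)
Require Import Defs.
From HB Require Import structures.
From mathcomp Require Import all_boot all_order all_algebra.
From mathcomp Require Import lra.
From mathcomp Require Import all_classical all_reals metric_structure.
Import Order.TTheory GRing.Theory Num.Theory.
Local Open Scope classical_set_scope.
Local Open Scope ring_scope.

Set Implicit Arguments.
Unset Strict Implicit.
Unset Printing Implicit Defensive.

(** Every mapping prescribes an edit path of the same cost: delete the edges
   coupled with [Deletion], ghost those coupled with [Ghosting], shrink the
   remaining edges to the weights of their partners, and run the same recipe
   backwards on [T'] ([mapping_costs]).  The two reduced trees match because a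
   tree obtained by deletions and ghostings carries the order of the original
   tree, and that order determines the parents ([induced], [up_embedding]).

   Conversely, every edit path from [T] to [T'] can be turned into a mapping
   which is not more expensive.  The induction on the path needs an invariant
   that survives one more edit in front, and mappings are awkward for that
   purpose: which edges are ghosted, and the name of a merged edge, change with
   every splitting.  The proof replaces them by a pair of labellings
   [r : edge T -> option L] and [r' : edge T' -> option L].  The label [None]
   marks the deleted edges, and the edges with a common label are those that
   will be merged into one.  Each label class must be a chain, and different
   labels must be ordered in the same way in both trees ([compatible]).  The
   cost of such a pair compares, label by label, the products of the weights of
   the two classes ([mcost]); in this form it is a Lipschitz function of the
   weights, which settles shrinkings, deletions and insertions.  Labels used in
   only one tree can always be replaced by [None] at no cost ([tighten]).

   The edit that needs an idea is the splitting of an edge into [e] and its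
   only child [c]: undoing it requires [e] and [c] to have the same label.  If
   one of them is deleted, it takes the label of the other, and the triangle
   inequality shows that this is not more expensive.  If they have two distinct
   labels, these labels are merged in both trees; this preserves compatibility
   because [e] and [c] are indistinguishable for the order of the other edges
   ([twins], [compatible_merge]), and translation invariance of the distance
   bounds the cost ([mcost_relabel]).

   At the end, coupling the lowest edges of the two classes of each label,
   and ghosting the rest of these classes, yields a genuine mapping
   ([labelling_mapping]).

   There are finitely many mappings, so that the infimum over all paths is
   attained by a mapping, hence by a path.  Reversing and concatenating paths
   gives the pseudo-metric. *)

(** * The order of a dendrogram *)
Lemma eq_Some (E : eqType) (x y : E) : (Some x == Some y) = (x == y).
Proof. by []. Qed.

Section Ancestors.
Context {R : realType} {X : editableSpace R} (T : dendrogram X).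
Implicit Types (u v : edge T) (a b c : option (edge T)).

Definition ble a b := connect (child (@parent R X T)) a b.

Lemma ble_refl a : ble a a. Proof. exact: connect0. Qed.
Lemma ble_trans b a c : ble a b -> ble b c -> ble a c.
Proof. exact: connect_trans. Qed.
Lemma ble_root a : ble a None. Proof. exact: to_root. Qed.
Hint Resolve ble_refl ble_root : core.

Lemma ble_step u b : ble (Some u) b = (Some u == b) || ble (parent u) b.
Proof.
apply/idP/idP => [/connectP[[|c p] /= ]|/orP[/eqP<-|le_pb]] //.
- by move=> _ ->; rewrite eqxx.
- by case/andP=> /eqP<- pp ->; apply/orP; right; apply/connectP; exists p.
- by apply: ble_trans le_pb; apply: connect1; rewrite /= eqxx.
Qed.

Lemma ble_None b : ble None b = (b == None).
Proof.
apply/idP/eqP => [/connectP[[|c p] //=]|->] //.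
Qed.

Lemma parent_ind (P : edge T -> Prop) :
  (forall u, (forall v, parent u = Some v -> P v) -> P u) -> forall u, P u.
Proof.
move=> IH u; have /connectP[p] := to_root (Some u).
elim: p u => [//|c p IHp] u /= /andP[/eqP pu pp] lastp.
by apply: IH => v pv; apply: IHp; rewrite -?pv ?pu.
Qed.

(** This is the acyclicity of the tree.  A cycle through [u] would be a cycle
   through its parent, and going up one ends at the root, which is on none. *)
Lemma parent_not_ble u : ~~ ble (parent u) (Some u).
Proof.
elim/parent_ind: u => u IH; apply/negP.
case E: (parent u) => [v|]; last by rewrite ble_None.
move=> le_vu; have /negP[] := IH v E; have le_uv : ble (Some u) (Some v).
  by rewrite ble_step E ble_refl orbT.
move: (le_vu); rewrite ble_step => /orP[/eqP[vu]|];
  last by move/ble_trans; apply.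
by rewrite -[v in parent v]/v vu E vu ble_refl.
Qed.

Lemma belowE u b : below (Some u) b = ble (parent u) b.
Proof.
rewrite /below -/(ble _ _) ble_step; case: eqVneq => //= <-.
by rewrite (negPf (parent_not_ble u)).
Qed.

Lemma ble_eqVbelow a b : ble a b = (a == b) || below a b.
Proof.
by rewrite /below -/(ble _ _); case: eqVneq => // <-; rewrite ble_refl.
Qed.

Lemma below_ble a b : below a b -> ble a b.
Proof. by case/andP. Qed.

Lemma ble_below_trans a b c : ble a b -> below b c -> below a c.
Proof.
case: b => [v|]; last by rewrite /below -/(ble _ _) ble_None eq_sym andNb.
rewrite /below -!/(ble _ _) => ab /andP[vc le_vc].
rewrite (ble_trans ab) // andbT.
apply/eqP=> ac; rewrite ac in ab.
have := le_vc; rewrite ble_step (negPf vc) /=.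
by move/ble_trans=> /(_ _ ab); apply/negP/parent_not_ble.
Qed.

Lemma below_ble_trans a b c : below a b -> ble b c -> below a c.
Proof.
move=> ab; rewrite ble_eqVbelow => /orP[/eqP<- //|].
exact/ble_below_trans/below_ble.
Qed.

Lemma below_trans a b c : below a b -> below b c -> below a c.
Proof. by move=> ab /below_ble; apply: below_ble_trans. Qed.

Lemma below_irr a : ~~ below a a. Proof. by rewrite /below eqxx. Qed.

Lemma ble_anti a b : ble a b -> ble b a -> a = b.
Proof.
rewrite ble_eqVbelow => /orP[/eqP//|ab] /(below_ble_trans ab).
by rewrite (negPf (below_irr a)).
Qed.

Lemma above_ind (P : edge T -> Prop) :
  (forall u, (forall v, below (Some u) (Some v) -> P v) -> P u) ->
  forall u, P u.
Proof.
move=> IH u; apply: (IH); elim/parent_ind: u => u IHu v.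
rewrite belowE; case E: (parent u) => [w|]; last by rewrite ble_None.
rewrite ble_eqVbelow => /orP[/eqP[<-]|]; last exact: IHu.
exact/IH/IHu.
Qed.

End Ancestors.
#[export] Hint Resolve ble_refl ble_root : core.

(** * Trees carrying the order of an ambient dendrogram *)
Section Induced.
Context {R : realType} {X : editableSpace R} (T : dendrogram X).
Implicit Types (u v e : edge T) (t : wtree (X := X) (edge T)).

(** The edges above a given edge being linearly ordered, [up t u] is thus forced
   to be the lowest vertex of [t] strictly above [u]. *)
Definition induced t := forall u, u \in live t ->
  [/\ below (Some u) (up t u),
      forall v, up t u = Some v -> v \in live t &
      forall v, v \in live t -> below (Some u) (Some v) ->
        ble (up t u) (Some v)].

Lemma induced_whole : induced (whole T).
Proof.
move=> u _; split=> /= [|v _|v _]; rewrite ?inE ?belowE //.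
Qed.

(** Deletion and ghosting change the tree structure in the same way, hence the
   arbitrary weights [w].  If [e] was the nearest vertex above [u], the nearest
   one above [e] takes its place. *)
Lemma induced_remove t e (w : edge T -> X) : induced t -> e \in live t ->
  induced (WTree (live t :\ e) (up (delete t e)) w).
Proof.
move=> it et u /=; rewrite in_setD1 => /andP[ue ut].
have [uup liveup nearest] := it u ut.
have [eup eliveup enearest] := it e et.
case: (eqVneq (up t u) (Some e)) => [ue'|nue].
  rewrite ue' in uup; split; first exact: below_trans uup eup.
    move=> v ev; rewrite in_setD1 (eliveup _ ev) andbT.
    by apply: contraL eup => /eqP ve; rewrite ev ve below_irr.
  move=> v; rewrite in_setD1 => /andP[ve vt] uv; apply: enearest => //.
  move: (nearest v vt uv); rewrite ue' ble_eqVbelow => /orP[/eqP[ev]|//].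
  by rewrite ev eqxx in ve.
split=> // v; last by rewrite in_setD1 => /andP[_]; apply: nearest.
move=> uv; rewrite in_setD1 liveup // andbT.
by apply: contra_neq nue => <-.
Qed.

Lemma induced_delete t e : induced t -> e \in live t -> induced (delete t e).
Proof. exact: induced_remove. Qed.

Lemma induced_ghost t e : induced t -> e \in live t -> induced (ghost t e).
Proof. exact: induced_remove. Qed.

Lemma nearest_ble t u b : induced t -> u \in live t ->
  (forall v, b = Some v -> v \in live t) -> below (Some u) b ->
  ble (up t u) b.
Proof.
move=> it ut; case: b => [v|//] lb; have [_ _] := it u ut; apply; exact: lb.
Qed.

Lemma live_below_ind t (P : edge T -> Prop) : induced t ->
  (forall u, u \in live t -> (forall v, up t u = Some v -> P v) -> P u) ->
  forall u, u \in live t -> P u.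
Proof.
move=> it IH u; elim/(@above_ind _ _ T): u => u IHu ut; apply: IH => // v uv.
have [+ /(_ v uv) vt _] := it u ut; rewrite uv => /IHu; exact.
Qed.

(** Climb from [v] along [up t]; since [g] is above [v], the climb cannot jump
   over [g], and the last edge before [g] is the child wanted. *)
Lemma child_above t v g : induced t -> v \in live t -> g \in live t ->
  below (Some v) (Some g) ->
  exists2 c, c \in live t & up t c = Some g /\ ble (Some v) (Some c).
Proof.
move=> it vt gt; move: v vt; apply: (live_below_ind it) => v vt IH vg.
have [vup liveup nearest] := it v vt.
have := nearest g gt vg; rewrite ble_eqVbelow => /orP[/eqP upv|].
  by exists v.
case E: (up t v) IH => [w|] IH; last by rewrite /below -/(ble _ _) ble_None.
move=> wg; have [c ct [upc wc]] := IH w erefl wg.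
by exists c => //; split=> //; apply/below_ble/(below_ble_trans _ wc); rewrite -E.
Qed.

(** Parents determine the order in both trees, but [up t] skips the edges of [T]
   that are not in [t]; that [t] is induced makes up for this. *)
Lemma iso_below t (S : dendrogram X) (f : edge S -> edge T) :
  induced t -> injective f -> [set f x | x in edge S]%SET = live t ->
  (forall x, up t (f x) = omap f (parent x)) ->
  forall x y, below (Some x) (Some y) = below (Some (f x)) (Some (f y)).
Proof.
move=> it injf imf upf x y.
have ft z : f z \in live t by rewrite -imf imset_f.
apply/idP/idP; elim/(@parent_ind _ _ S): x => x IH.
  rewrite belowE; case E: (parent x) => [z|]; last by rewrite ble_None.
  have [+ _ _] := it (f x) (ft x); rewrite upf E /= => fxz.
  rewrite ble_eqVbelow => /orP[/eqP[<-//]|/(IH z E)].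
  exact: below_trans fxz.
move=> fxy; have [_ _] := it (f x) (ft x).
move=> /(_ _ (ft y) fxy); rewrite upf belowE.
case E: (parent x) => [z|] /=; last by rewrite !ble_None.
by rewrite !ble_eqVbelow => /orP[/eqP[/injf->]|/(IH z E) ->];
  rewrite ?eqxx ?orbT.
Qed.

(** An edit path runs through dendrograms and not through edited trees; this
   gives the intermediate stations of the paths constructed below. *)
Lemma realize t : induced t -> {in live t, forall u, wt t u != ezero} ->
  exists S : dendrogram X, iso S t.
Proof.
move=> it wt0.
pose par (x : {u | u \in live t}) : option {u | u \in live t} :=
  obind insub (up t (val x)).
have parE x : up t (val x) = omap val (par x).
  rewrite /par; have [_ liveup _] := it _ (valP x).
  case E: (up t (val x)) => [v|] //=.
  by rewrite (insubT (fun u => u \in live t) (liveup _ E)).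
have root a : connect (child par) a None.
  case: a => [x|]; last exact: connect0.
  case: x => u ut; elim/(@above_ind _ _ T): u ut => u IH ut.
  have [uup liveup _] := it _ ut.
  apply: (@connect_trans _ _ (par (exist _ u ut))).
    by apply: connect1; rewrite /= eqxx.
  have := parE (exist _ u ut); case: (par _) => [[v vt]|] /= E //.
  by apply: IH; rewrite -E.
pose S := @Dendrogram R X {u | u \in live t} par (fun x => wt t (val x)) root
  (fun x => wt0 _ (valP x)).
exists S, val; split; [exact: val_inj | | exact: parE | by []].
apply/setP=> u; apply/imsetP/idP => [[x _ ->]|ut]; first exact: (valP x).
by exists (exist _ u ut).
Qed.

End Induced.

(** * Edits and isomorphisms *)
Section Isomorphisms.
Context {R : realType} {X : editableSpace R}.
Local Notation wtree := (wtree (X := X)).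

(** Isomorphism of edited trees.  All conditions are restricted to live edges, as
   the data of the other ones are arbitrary. *)
Definition wiso (E F : finType) (g : E -> F) (s : wtree E) (t : wtree F) :=
  [/\ {in live s &, injective g}, [set g u | u in live s]%SET = live t,
      {in live s, forall u, up t (g u) = omap g (up s u)} &
      {in live s, forall u, wt t (g u) = wt s u}].

Definition upclosed (E : finType) (s : wtree E) :=
  forall u, u \in live s -> forall v, up s u = Some v -> v \in live s.

Lemma in_whole (S : dendrogram X) (e : edge S) : e \in live (whole S).
Proof. by rewrite inE. Qed.
Hint Resolve in_whole : core.

Lemma upclosed_whole (S : dendrogram X) : upclosed (whole S).
Proof. by move=> u _ v _; rewrite inE. Qed.

Lemma iso_wiso (S : dendrogram X) (E : finType) (t : wtree E) :
  iso S t <-> exists f, wiso f (whole S) t.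
Proof.
have imT (f : edge S -> E) :
    [set f x | x in live (whole S)]%SET = [set f x | x in edge S]%SET.
  by apply/setP=> y; apply/imsetP/imsetP=> -[x _ ->]; exists x; rewrite ?inE.
split=> -[f [injf imf upf wtf]]; exists f; split=> //.
- by move=> x y _ _; apply: injf.
- by rewrite imT.
- by move=> x y; apply: injf; rewrite inE.
- by rewrite -imT.
- by move=> x; rewrite upf ?inE.
- by move=> x; rewrite wtf ?inE.
Qed.

Section Wiso.
Context (E F : finType) (g : E -> F) (s : wtree E) (t : wtree F).
Hypotheses (clos : upclosed s) (gst : wiso g s t).

Let gt u : u \in live s -> g u \in live t.
Proof. by have [_ <- _ _] := gst; apply: imset_f. Qed.

Lemma iso_push (S : dendrogram X) : iso S s -> iso S t.
Proof.
have [injg img upg wtg] := gst => -[f [injf imf upf wtf]].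
have fs x : f x \in live s by rewrite -imf imset_f.
exists (g \o f); split=> [x y /= /injg eq_f|||] /=.
- by apply: injf; apply: eq_f.
- by rewrite imset_comp imf img.
- by move=> x; rewrite upg // upf; case: (parent x).
- by move=> x; rewrite wtg.
Qed.

Lemma iso_pull (S : dendrogram X) : iso S t -> iso S s.
Proof.
have [injg img upg wtg] := gst => -[f [injf imf upf wtf]].
have ft x : f x \in live t by rewrite -imf imset_f.
have /choice[h hP] x : exists u, u \in live s /\ g u = f x.
  by move: (ft x); rewrite -img => /imsetP[u us ->]; exists u.
have hs x : h x \in live s by have [] := hP x.
have gh x : g (h x) = f x by have [] := hP x.
exists h; split=> [x y hxy|||].
- by apply: injf; rewrite -!gh hxy.
- apply/setP=> u; apply/imsetP/idP => [[x _ ->]//|us].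
  move: (gt us); rewrite -imf => /imsetP[x _ gu]; exists x => //.
  by apply: injg; rewrite // gu gh.
- move=> x; have := upg _ (hs x); rewrite gh upf.
  case E1: (up s (h x)) => [u|]; case: (parent x) => [y|] //=.
  rewrite -gh => -[] /injg -> //; exact: (clos (hs x)).
- by move=> x; rewrite -wtg // gh.
Qed.

Let up_eq u e : u \in live s -> e \in live s ->
  (up t (g u) == Some (g e)) = (up s u == Some e).
Proof.
have [injg img upg wtg] := gst => us es; rewrite upg //.
case E1: (up s u) => [v|] //=; apply/eqP/eqP => [[]|[->]//].
by move/(injg _ _ (clos us E1) es) ->.
Qed.

Let live_rem e : e \in live s ->
  [set g u | u in live s :\ e]%SET = live t :\ g e.
Proof.
have [injg img upg wtg] := gst => es; apply/setP => w.
rewrite in_setD1 -img; apply/imsetP/andP => [[u]|[]].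
  rewrite in_setD1 => /andP[ue us] ->; split; last exact: imset_f.
  by apply: contra_neq ue; apply: injg.
move=> wge /imsetP[u us wu]; exists u => //; rewrite {}wu in wge.
by rewrite in_setD1 us andbT; apply/eqP => ue; rewrite ue eqxx in wge.
Qed.

Let up_rem e u : e \in live s -> u \in live s ->
  up (delete t (g e)) (g u) = omap g (up (delete s e) u).
Proof.
have [injg img upg wtg] := gst => es us /=.
by rewrite up_eq //; case: ifP; rewrite upg.
Qed.

Lemma wiso_delete e : e \in live s -> wiso g (delete s e) (delete t (g e)).
Proof.
have [injg img upg wtg] := gst => es; split.
- by move=> u v /setD1P[_ ?] /setD1P[_ ?]; apply: injg.
- exact: live_rem.
- by move=> u /setD1P[_ us]; apply: up_rem.
- by move=> u /setD1P[_ us]; apply: wtg.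
Qed.

Lemma wiso_ghost e : e \in live s -> wiso g (ghost s e) (ghost t (g e)).
Proof.
have [injg img upg wtg] := gst => es; split.
- by move=> u v /setD1P[_ ?] /setD1P[_ ?]; apply: injg.
- exact: live_rem.
- by move=> u /setD1P[_ us]; apply: up_rem.
- by move=> u /setD1P[_ us] /=; rewrite up_eq // !wtg.
Qed.

Lemma wiso_shrink e y : e \in live s ->
  wiso g (shrink s e y) (shrink t (g e) y).
Proof.
have [injg img upg wtg] := gst => es; split=> // u us /=.
by rewrite (inj_in_eq injg) // wtg.
Qed.

Lemma wiso_degree2 e : e \in live s -> degree2 t (g e) = degree2 s e.
Proof.
have [injg img upg wtg] := gst => es; rewrite /degree2 es gt //=.
suff -> : [set w in live t | up t w == Some (g e)] =
    [set g u | u in [set u in live s | up s u == Some e]]%SET.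
  by rewrite card_in_imset // => u v; rewrite !inE => /andP[? _] /andP[? _];
    apply: injg.
apply/setP=> w; rewrite inE -img; apply/andP/imsetP => [[/imsetP[u us ->]]|[u]].
  by rewrite up_eq // => ue; exists u; rewrite // inE us.
by rewrite inE => /andP[us ue] ->; rewrite imset_f // up_eq.
Qed.

End Wiso.

Lemma upclosed_remove (E : finType) (s : wtree E) e w : e \in live s ->
  upclosed s -> up s e != Some e ->
  upclosed (WTree (live s :\ e) (up (delete s e)) w).
Proof.
move=> es cs upe u /setD1P[ue us] v /=; case: (eqVneq (up s u)) => [uE|neq] uv.
  by rewrite in_setD1 (cs _ es _ uv) andbT; apply/eqP=> ve;
    rewrite uv ve eqxx in upe.
by rewrite in_setD1 (cs _ us _ uv) andbT; apply/eqP=> ve;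
  rewrite uv ve eqxx in neq.
Qed.

Lemma dendro_iso_refl (T : dendrogram X) : dendro_iso T T.
Proof.
exists id; split; [by [] | | by move=> e /=; case: (parent e) | by []].
by apply/setP=> u; rewrite inE; apply/imsetP; exists u.
Qed.

Lemma dendro_iso_sym (S T : dendrogram X) : dendro_iso S T -> dendro_iso T S.
Proof.
move=> /iso_wiso[f fP].
exact/(iso_pull (@upclosed_whole S) fP)/dendro_iso_refl.
Qed.

Lemma iso_trans (S T : dendrogram X) (E : finType) (t : wtree E) :
  dendro_iso S T -> iso T t -> iso S t.
Proof. by move=> ST /iso_wiso[f fP]; apply: (iso_push fP ST). Qed.

Lemma iso_common (S S' : dendrogram X) (E : finType) (t : wtree E) :
  iso S t -> iso S' t -> dendro_iso S S'.
Proof.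
by move=> St /iso_wiso[f fP]; apply: (iso_pull (@upclosed_whole S') fP St).
Qed.

Lemma up_neq (T : dendrogram X) (t : wtree (edge T)) e :
  induced t -> e \in live t -> up t e != Some e.
Proof.
by move=> it /it[+ _ _]; apply: contraTneq => ->; apply: below_irr.
Qed.

Lemma iso_delete (S S' : dendrogram X) (E : finType) (t : wtree E)
    (f : edge S -> E) e :
  wiso f (whole S) t -> iso S' (delete t (f e)) <-> iso S' (delete (whole S) e).
Proof.
move=> fP; have cS : upclosed (delete (whole S) e).
  apply: upclosed_remove => //; apply: up_neq => //; exact: induced_whole.
have fP' : wiso f (delete (whole S) e) (delete t (f e)).
  by apply: wiso_delete => //; apply: upclosed_whole.
by split; [exact: (iso_pull cS fP')|exact: (iso_push fP')].
Qed.

Lemma iso_ghost (S S' : dendrogram X) (E : finType) (t : wtree E)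
    (f : edge S -> E) e :
  wiso f (whole S) t -> iso S' (ghost t (f e)) <-> iso S' (ghost (whole S) e).
Proof.
move=> fP; have cS : upclosed (ghost (whole S) e).
  apply: upclosed_remove => //; apply: up_neq => //; exact: induced_whole.
have fP' : wiso f (ghost (whole S) e) (ghost t (f e)).
  by apply: wiso_ghost => //; apply: upclosed_whole.
by split; [exact: (iso_pull cS fP')|exact: (iso_push fP')].
Qed.

Lemma iso_shrink (S S' : dendrogram X) (E : finType) (t : wtree E)
    (f : edge S -> E) e y :
  wiso f (whole S) t ->
  iso S' (shrink t (f e) y) <-> iso S' (shrink (whole S) e y).
Proof.
move=> fP; have cS : upclosed (shrink (whole S) e y) by apply: upclosed_whole.
have fP' : wiso f (shrink (whole S) e y) (shrink t (f e) y).
  by apply: wiso_shrink => //; apply: upclosed_whole.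
by split; [exact: (iso_pull cS fP')|exact: (iso_push fP')].
Qed.

Lemma degree2_iso (S : dendrogram X) (E : finType) (t : wtree E)
    (f : edge S -> E) e :
  wiso f (whole S) t -> degree2 t (f e) = degree2 (whole S) e.
Proof.
by move=> fP; apply: wiso_degree2 => //; apply: upclosed_whole.
Qed.

End Isomorphisms.
#[export] Hint Resolve in_whole : core.

(** * Reversing and concatenating edit paths *)
Section Paths.
Context {R : realType} {X : editableSpace R}.
Local Notation wtree := (wtree (X := X)).
Implicit Types (T S : dendrogram X).

Lemma costs_stop T T' : dendro_iso T T' -> path_costs T T' 0.
Proof. by move=> TT'; exists (Stop TT'). Qed.

Lemma costs_step T T1 T' (s : edit T T1) c :
  path_costs T1 T' c -> path_costs T T' (edit_cost s + c).
Proof. by move=> [g <-]; exists (Step s g). Qed.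

Lemma edit_cost_ge0 T T1 (s : edit T T1) : 0 <= edit_cost s.
Proof. by case: s => *; rewrite ?mdist_ge0. Qed.

Lemma costs_ge0 T T' c : path_costs T T' c -> 0 <= c.
Proof.
move=> [g <-]; elim: g => //= {}T T1 {}T' s g IH.
by rewrite addr_ge0 ?edit_cost_ge0.
Qed.

(** Paths can be concatenated only if their end and start are linked by an
   isomorphism, which the first edit of the second path absorbs. *)
Lemma edit_transport S T T1 (s : edit T T1) : dendro_iso S T ->
  exists s' : edit S T1, edit_cost s' = edit_cost s.
Proof.
move=> ST; have /iso_wiso[f fP] := dendro_iso_sym ST.
have [_ _ _ wtf] := fP.
case: s => [e y y0 i|e i|e i|e d i|e d i].
- have i' : iso T1 (shrink (whole S) (f e) y) by apply/(iso_shrink _ _ _ fP).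
  by exists (Shrink y0 i') => /=; rewrite [weight _]wtf ?inE.
- have i' : iso T1 (delete (whole S) (f e)) by apply/(iso_delete _ _ fP).
  by exists (Delete i') => /=; rewrite [weight _]wtf ?inE.
- by exists (Insert (iso_trans ST i)).
- have i' : iso T1 (ghost (whole S) (f e)) by apply/(iso_ghost _ _ fP).
  have d' : degree2 (whole S) (f e) by rewrite (degree2_iso _ fP).
  by exists (Ghost d' i').
- by exists (Defs.Split d (iso_trans ST i)).
Qed.

Lemma costs_trans T T' T'' c c' :
  path_costs T T' c -> path_costs T' T'' c' -> path_costs T T'' (c + c').
Proof.
move=> [g <-]; elim: g c' => /= [{}T {}T' TT' c'|{}T T1 {}T' s g IH c' /IH].
  rewrite add0r => -[g <-]; case: g TT' => [T1 T2 T12|T1 T2 T3 s g] TT1 /=.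
    exact/costs_stop/(iso_trans TT1).
  have [s' <-] := edit_transport s TT1.
  by apply: costs_step; exists g.
by rewrite -addrA; apply: costs_step.
Qed.

(** Insertions and splittings are by definition reversed deletions and ghostings.
   A shrinking is undone by restoring the old weight. *)
Lemma edit_reverse T T1 (s : edit T T1) :
  exists s' : edit T1 T, edit_cost s' = edit_cost s.
Proof.
case: s => [e y y0 i|e i|e i|e d i|e d i].
- have [f fP] := (iso_wiso _ _).1 i; have [injf imf upf wtf] := fP.
  have /imsetP[x _ ex] : e \in [set f x | x in live (whole T1)]%SET.
    by rewrite imf inE.
  have i' : iso T (shrink (whole T1) x (weight e)).
    apply/(iso_shrink _ _ _ fP); rewrite -ex.
    have [h [injh imh uph wth]] := dendro_iso_refl T.
    exists h; split=> // u; rewrite /= -[RHS]wth.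
    by case: eqP => [->|].
  exists (Shrink (weight_neq0 e) i') => /=.
  have := wtf x (in_whole x); rewrite /= -ex eqxx => <-.
  by rewrite metric_sym.
- by exists (Insert i).
- by exists (Delete i).
- by exists (Defs.Split d i).
- by exists (Ghost d i).
Qed.

Lemma costs_sym T T' c : path_costs T T' c -> path_costs T' T c.
Proof.
move=> [g <-]; elim: g => /= [{}T {}T' TT'|{}T T1 {}T' s g IH].
  exact/costs_stop/dendro_iso_sym.
have [s' <-] := edit_reverse s; rewrite addrC; apply: costs_trans IH _.
by rewrite -[edit_cost _]addr0; apply/costs_step/costs_stop/dendro_iso_refl.
Qed.

End Paths.

(** * The cost of a pair of labellings *)
Lemma big_option (S : Type) (idx : S) (op : Monoid.com_law idx) (L : finType)
    (P : pred (option L)) (F : option L -> S) :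
  \big[op/idx]_(o | P o) F o =
  op (if P None then F None else idx) (\big[op/idx]_(a | P (Some a)) F (Some a)).
Proof.
rewrite big_mkcond (bigD1 None) //=; congr (op _ _).
rewrite (reindex_omap Some id) => [|[a|]] //=.
by rewrite [RHS]big_mkcond; apply: eq_bigl => a; rewrite eqxx.
Qed.

Section Costs.
Context {R : realType} {X : editableSpace R}.
Implicit Types x y z : X.

Lemma eopA x y z : eop x (eop y z) = eop (eop x y) z.
Proof. exact: Monoid.mulmA. Qed.

Lemma eopC x y : eop x y = eop y x.
Proof. exact: Monoid.mulmC. Qed.

Lemma eop0x x : eop ezero x = x.
Proof. exact: Monoid.mul1m. Qed.

Definition norm x : R := mdist x ezero.

Lemma norm_ge0 x : 0 <= norm x. Proof. exact: mdist_ge0. Qed.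

Lemma norm0 : norm ezero = 0. Proof. exact: mdistxx. Qed.

Lemma normD x y : norm (eop x y) = norm x + norm y.
Proof. by rewrite /norm metric_sym editD metric_sym (metric_sym _ y). Qed.

Lemma norm_big (I : Type) (s : seq I) (P : pred I) (F : I -> X) :
  norm (\big[eop/ezero]_(i <- s | P i) F i) = \sum_(i <- s | P i) norm (F i).
Proof. by apply: (big_morph norm normD norm0). Qed.

Lemma mdist_eopl z x y : mdist (eop z x) (eop z y) = mdist x y.
Proof. by have [] := editI x y z. Qed.

Lemma mdist_eopr z x y : mdist (eop x z) (eop y z) = mdist x y.
Proof. by have [] := editI x y z. Qed.

Lemma mdist_absorb z x : mdist (eop z x) x = norm z.
Proof. by rewrite -[X in mdist _ X]eop0x mdist_eopr. Qed.

Lemma mdistD x y x' y' :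
  mdist (eop x y) (eop x' y') <= mdist x x' + mdist y y'.
Proof.
rewrite -(mdist_eopr y x x') -(mdist_eopl x' y y').
exact: metric_triangle.
Qed.

Lemma mdist_big (I : Type) (s : seq I) (P : pred I) (F G : I -> X) :
  mdist (\big[eop/ezero]_(i <- s | P i) F i) (\big[eop/ezero]_(i <- s | P i) G i)
  <= \sum_(i <- s | P i) mdist (F i) (G i).
Proof.
elim/big_rec3: _ => [|i z x y _ le_xyz]; first by rewrite mdistxx.
by rewrite (le_trans (mdistD _ _ _ _)) // lerD2l.
Qed.

Lemma norm_le x y : norm x <= norm y + mdist x y.
Proof. by rewrite addrC; apply: metric_triangle. Qed.

Section LabelCost.
Context {L : finType}.
Implicit Types A B : option L -> X.

(** Here [A o] and [B o] stand for the products of the weights of the edges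
   labelled [o] in the two trees.  Since the norm is additive, the norm of a
   product is the total cost of deleting its factors. *)
Definition mcost A B : R :=
  norm (A None) + norm (B None) + \sum_(a : L) mdist (A (Some a)) (B (Some a)).

Lemma mcost_lipschitz A A' B :
  mcost A' B <= \sum_o mdist (A' o) (A o) + mcost A B.
Proof.
rewrite /mcost big_option /=.
have nA : norm (A' None) <= norm (A None) + mdist (A' None) (A None).
  exact: norm_le.
have sA : \sum_(a : L) mdist (A' (Some a)) (B (Some a)) <=
    \sum_(a : L) mdist (A' (Some a)) (A (Some a)) +
    \sum_(a : L) mdist (A (Some a)) (B (Some a)).
  by rewrite -big_split; apply: ler_sum => a _; apply: metric_triangle.
lra.
Qed.

End LabelCost.

(** Merging labels does not raise the cost, because the distance between products
   is at most the sum of the distances between their factors.  A label may be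
   sent to [None] when its class is empty on one side: deleting the other class
   costs its distance to [ezero]. *)
Lemma mcost_relabel (L K : finType) (h : L -> option K) (A B : option L -> X) :
  (forall a, h a = None -> A (Some a) = ezero \/ B (Some a) = ezero) ->
  mcost (fun o => \big[eop/ezero]_(o' | obind h o' == o) A o')
        (fun o => \big[eop/ezero]_(o' | obind h o' == o) B o') <= mcost A B.
Proof.
move=> h0; rewrite /mcost !big_option /= !normD !norm_big.
have -> : \sum_(a : L) mdist (A (Some a)) (B (Some a)) =
    \sum_(a : L | h a == None) mdist (A (Some a)) (B (Some a)) +
    \sum_(k : K) \sum_(a : L | h a == Some k) mdist (A (Some a)) (B (Some a)).
  by rewrite (partition_big h predT) //= big_option.
have s0 : \sum_(a : L | h a == None) norm (A (Some a)) +
    \sum_(a : L | h a == None) norm (B (Some a)) <=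
    \sum_(a : L | h a == None) mdist (A (Some a)) (B (Some a)).
  rewrite -big_split /=; apply: ler_sum => a /eqP /h0[] ->.
    by rewrite norm0 add0r metric_sym.
  by rewrite norm0 addr0.
have s1 : \sum_(k : K) mdist (\big[eop/ezero]_(o' | obind h o' == Some k) A o')
      (\big[eop/ezero]_(o' | obind h o' == Some k) B o') <=
    \sum_(k : K) \sum_(a : L | h a == Some k) mdist (A (Some a)) (B (Some a)).
  apply: ler_sum => k _; rewrite !big_option /= !eop0x.
  exact: mdist_big.
lra.
Qed.

End Costs.

(** * Compatible labellings *)
Section Labelings.
Context {R : realType} {X : editableSpace R}.
Local Notation wtree := (wtree (X := X)).
Local Notation lower u v := (below (Some u) (Some v)).

Definition fiber_weight (E L : finType) (t : wtree E) (r : E -> option L)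
    (o : option L) : X :=
  \big[eop/ezero]_(u in live t | r u == o) wt t u.

Lemma fiber_weight_relabel (E L K : finType) (t : wtree E) (r : E -> option L)
    (h : L -> option K) o :
  fiber_weight t (obind h \o r) o =
  \big[eop/ezero]_(o' | obind h o' == o) fiber_weight t r o'.
Proof.
rewrite /fiber_weight (partition_big r (fun o' => obind h o' == o)) /=.
  apply: eq_bigr => o' /eqP ho'; apply: eq_bigl => u.
  by case: (eqVneq (r u) o') => [->|_]; rewrite ?andbF ?ho' ?eqxx ?andbT.
by move=> u /andP[].
Qed.

Lemma mcost_fiber_relabel (E E' L K : finType) (t : wtree E) (t' : wtree E')
    (r : E -> option L) (r' : E' -> option L) (h : L -> option K) :
  (forall a, h a = None ->
    fiber_weight t r (Some a) = ezero \/ fiber_weight t' r' (Some a) = ezero) ->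
  mcost (fiber_weight t (obind h \o r)) (fiber_weight t' (obind h \o r')) <=
  mcost (fiber_weight t r) (fiber_weight t' r').
Proof.
move/mcost_relabel; congr (_ <= _).
by congr mcost; apply/funext => o; rewrite fiber_weight_relabel.
Qed.

Lemma fiber_weightD1 (E L : finType) (t : wtree E) (r : E -> option L) e o :
  e \in live t ->
  fiber_weight t r o =
  eop (if r e == o then wt t e else ezero) (fiber_weight (delete t e) r o).
Proof.
move=> et; rewrite /fiber_weight /=; case: ifP => reo.
  rewrite (bigD1 e) ?et ?reo //=; congr (eop _ _); apply: eq_bigl => u.
  by rewrite in_setD1 andbAC -andbA andbCA andbA.
rewrite eop0x; apply: eq_bigl => u; rewrite in_setD1.
by case: (eqVneq u e) => [->|//]; rewrite reo !andbF.
Qed.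

(** The weight of [e] is handed over to [c], which has the same label. *)
Lemma fiber_weight_ghost (E L : finType) (t : wtree E) (r : E -> option L)
    e c o :
  e \in live t -> c != e ->
  [set u in live t | up t u == Some e] = [set c]%SET ->
  r e = r c -> fiber_weight (ghost t e) r o = fiber_weight t r o.
Proof.
move=> et ce chE rec.
have /setIdP[ct upc] : c \in [set u in live t | up t u == Some e].
  by rewrite chE set11.
rewrite (fiber_weightD1 _ _ et) (@fiber_weightD1 _ _ (delete t e) _ c) /=;
  last by rewrite in_setD1 ce.
rewrite (@fiber_weightD1 _ _ (ghost t e) _ c) /=; last by rewrite in_setD1 ce.
rewrite upc -rec eopA; congr (eop _ _).
  by case: ifP => _; [exact: eopC|rewrite eop0x].
apply: eq_bigr => u /=; rewrite !in_setD1 => /andP[/and3P[uc ue ut] _].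
case: ifP => // upu.
have : u \in [set u in live t | up t u == Some e] by rewrite inE ut.
by rewrite chE inE (negPf uc).
Qed.

(** Compatibility says nothing about the labels used in a single tree, so this is
   required in both directions whenever the order of two label classes in one
   tree is to be read off from the other tree. *)
Definition sublabels (E E' L : finType) (A : {set E}) (A' : {set E'})
    (r : E -> option L) (r' : E' -> option L) :=
  {in A, forall u, r u <> None -> exists2 u', u' \in A' & r' u' = r u}.

Section Compatible.
Context {T T' : dendrogram X}.
Implicit Types A B : {set edge T}.

(** The sets [A] and [A'] are the live edges of the two edited trees, which are
   ordered as in the ambient dendrograms. *)
Record compatible (L : finType) A (A' : {set edge T'}) (r : edge T -> option L)
    (r' : edge T' -> option L) : Prop := Compatible {
  chainl : {in A &, forall u v, r u = r v -> r u <> None ->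
    ble (Some u) (Some v) || ble (Some v) (Some u)} ;
  chainr : {in A' &, forall u v, r' u = r' v -> r' u <> None ->
    ble (Some u) (Some v) || ble (Some v) (Some u)} ;
  consistent : forall u v u' v', u \in A -> v \in A -> u' \in A' -> v' \in A' ->
    r u = r' u' -> r v = r' v' -> r u <> None -> r v <> None -> r u <> r v ->
    lower u v = lower u' v' }.

Definition labelling_le (t : wtree (edge T)) (t' : wtree (edge T')) (c : R) :=
  exists (L : finType) r r', [/\ @compatible L (live t) (live t') r r' &
    mcost (fiber_weight t r) (fiber_weight t' r') <= c].

Definition tight_le (t : wtree (edge T)) (t' : wtree (edge T')) (c : R) :=
  exists (L : finType) r r', [/\ @compatible L (live t) (live t') r r',
    sublabels (live t) (live t') r r', sublabels (live t') (live t) r' r &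
    mcost (fiber_weight t r) (fiber_weight t' r') <= c].

(** Deleting all edges whose label is missing in the other tree costs nothing:
   such a label already contributed the norms of the weights of its class. *)
Lemma tighten t t' c : labelling_le t t' c -> tight_le t t' c.
Proof.
move=> [L [r [r' [[chl chr cons] le_c]]]].
(* keep the labels used in both trees *)
pose h a := if [exists u in live t, r u == Some a] &&
  [exists u in live t', r' u == Some a] then Some a else None.
have hE a b : h a = Some b -> a = b by rewrite /h; case: ifP => // _ [].
have hE' (o : option L) b : obind h o = Some b -> o = Some b.
  by case: o => //= a /hE ->.
have hN o o' : obind h o = obind h o' -> obind h o <> None -> o = o'.
  by case E: (obind h o) => [b|//] E' _; rewrite (hE' _ _ E) (hE' o' b).
have nN o : obind h o <> None -> o <> None by case: o.
exists L, (obind h \o r), (obind h \o r'); split.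
- split=> /=.
  + by move=> u v ut vt /hN H N; apply: chl => //; [exact: H|exact: nN].
  + by move=> u v ut vt /hN H N; apply: chr => //; [exact: H|exact: nN].
  + move=> u v u' v' ut vt ut' vt' /hN Eu /hN Ev Nu Nv.
    have Nu' := nN _ Nu; have Nv' := nN _ Nv => Nuv.
    apply: cons => //; [exact: Eu|exact: Ev|].
    by move=> E; apply: Nuv; rewrite /= E.
- move=> u ut /=; case ru: (r u) => [a|//] /=; rewrite /h.
  case: ifP => // /andP[_ /existsP[u' /andP[ut' /eqP ru']]] _.
  exists u' => //; rewrite ru' /= /h; case: ifP => // /negP[].
  by apply/andP; split; apply/existsP; [exists u|exists u'];
    rewrite ?ut ?ut' ?ru ?ru' eqxx.
- move=> u' ut' /=; case ru': (r' u') => [a|//] /=; rewrite /h.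
  case: ifP => // /andP[/existsP[u /andP[ut /eqP ru]] _] _.
  exists u => //; rewrite ru /= /h; case: ifP => // /negP[].
  by apply/andP; split; apply/existsP; [exists u|exists u'];
    rewrite ?ut ?ut' ?ru ?ru' eqxx.
- apply: le_trans le_c.
  apply: mcost_fiber_relabel => a; rewrite /h; case: ifP => // /negbT.
  rewrite negb_and => /orP[] /existsPn none _; [left|right];
    by apply: big1 => u /andP[ut rua]; move: (none u); rewrite ut rua.
Qed.

Lemma compatibleS L A B (A' : {set edge T'}) r r' : B \subset A ->
  compatible A A' r r' -> @compatible L B A' r r'.
Proof.
move=> /fintype.subsetP BA [chl chr cons]; split=> //.
  by move=> u v /BA uA /BA vA; apply: chl.
by move=> u v u' v' /BA uA /BA vA; apply: cons.
Qed.

(** The order between two classes can be tested on representatives in the other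
   tree, where the choice of the representatives is free; hence it does not
   depend on them here either. *)
Lemma block L A (A' : {set edge T'}) r r' u u2 v :
  @compatible L A A' r r' -> sublabels A A' r r' ->
  u \in A -> u2 \in A -> v \in A -> r u = r u2 -> r u <> None -> r v <> None ->
  r u <> r v -> lower u v = lower u2 v /\ lower v u = lower v u2.
Proof.
move=> [_ _ cons] full uA u2A vA ru nu nv nuv.
have [u' u'A ru'] := full u uA nu; have [v' v'A rv'] := full v vA nv.
have ru2' : r u2 = r' u' by rewrite ru' ru.
split.
  by rewrite (cons u v u' v') ?(cons u2 v u' v') // -?ru.
rewrite (cons v u v' u') ?(cons v u2 v' u') -?ru //; exact/nesym.
Qed.

(** What the order of the other edges sees of an edge and its only child.  The
   condition is symmetric, since either of the two may have to take over the
   label of the other. *)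
Definition twins A (x y : edge T) :=
  [/\ x \in A, y \in A, x != y, lower x y || lower y x &
      {in A, forall v, v != x -> v != y ->
        lower x v = lower y v /\ lower v x = lower v y}].

Lemma twins_sym A x y : twins A x y -> twins A y x.
Proof.
move=> [xA yA xy cmp tw]; split=> //; rewrite ?[y == x]eq_sym 1?orbC //.
by move=> v vA vy vx; have [-> ->] := tw v vA vx vy.
Qed.

(** Mapping [x] to [y] and fixing all other edges preserves the order between
   distinct images, so composing the labels with this map is harmless. *)
Lemma compatible_twin L A (A' : {set edge T'}) r r' x y : twins A x y ->
  compatible (A :\ x) A' r r' ->
  @compatible L A A' (fun u => r (if u == x then y else u)) r'.
Proof.
move=> [xA yA xy cmp tw] [chl chr cons].
set f := fun u => if u == x then y else u.
have fA u : u \in A -> f u \in A :\ x.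
  by rewrite /f in_setD1; case: (eqVneq u x) => [_ _|-> //]; rewrite eq_sym xy.
have cmp' u : u \in A -> u != x ->
    (ble (Some y) (Some u) || ble (Some u) (Some y)) ->
    ble (Some x) (Some u) || ble (Some u) (Some x).
  move=> uA ux; case: (eqVneq u y) => [->|uy].
    by rewrite ![ble _ _]ble_eqVbelow; case/orP: cmp => ->; rewrite !orbT.
  have [e1 e2] := tw u uA ux uy.
  by rewrite ![ble _ _]ble_eqVbelow e1 e2 !eq_Some (negPf ux) (negPf uy)
    ![_ == u]eq_sym (negPf ux) (negPf uy).
split=> //.
- move=> u v uA vA ruv nu; have := chl _ _ (fA _ uA) (fA _ vA) ruv nu.
  rewrite /f; case: (eqVneq u x) => [->|ux]; case: (eqVneq v x) => [->|vx] //.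
  + by rewrite !ble_refl.
  + exact: cmp'.
  + by rewrite orbC => /(cmp' _ uA ux); rewrite orbC.
- move=> u v u' v' uA vA u'A v'A ru rv nu nv nuv.
  rewrite -(cons (f u) (f v) u' v' (fA _ uA) (fA _ vA)) //.
  have : f u != f v by apply/eqP => fuv; apply: nuv; rewrite -/(f u) fuv.
  rewrite /f; case: (eqVneq u x) => [->|ux]; case: (eqVneq v x) => [->|vx] //.
  + by rewrite eqxx.
  + by rewrite eq_sym => vy; have [-> _] := tw v vA vx vy.
  + by move=> uy; have [_ ->] := tw u uA ux uy.
Qed.

(** By [block], the order between classes is that between representatives.  For
   the classes [l] and [m] these can be taken to be [x] and [y], which compare
   in the same way with any edge outside of the two classes; so the order
   between classes survives the merging.  The union of the two classes is a
   chain because [x] and [y] are comparable. *)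
Lemma compatible_merge (L : finType) A (A' : {set edge T'})
    (r : edge T -> option L) (r' : edge T' -> option L) x y l m :
  compatible A A' r r' -> sublabels A A' r r' -> sublabels A' A r' r ->
  twins A x y -> r x = Some l -> r y = Some m -> l != m ->
  compatible A A' (obind (fun a => Some (if a == l then m else a)) \o r)
    (obind (fun a => Some (if a == l then m else a)) \o r').
Proof.
move=> pm full full' [xA yA xy cmp tw] rx ry lm; have [chl chr cons] := pm.
set g := fun a => if a == l then m else a.
set r2 := _ \o r; set r2' := _ \o r'.
have sameN (o o' : option L) : omap g o = omap g o' -> o <> None ->
    [\/ o = o', o = Some l /\ o' = Some m | o = Some m /\ o' = Some l].
  case: o => [a|//]; case: o' => [b|//] [] + _; rewrite /g.
  case: (eqVneq a l) => [->|_]; case: (eqVneq b l) => [->|_].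
  - by constructor 1.
  - by move=> ->; constructor 2.
  - by move=> <-; constructor 3.
  - by move=> ->; constructor 1.
have r2E u : r2 u = omap g (r u) by rewrite /r2 /=; case: (r u).
have r2E' u : r2' u = omap g (r' u) by rewrite /r2' /=; case: (r' u).
have NN (o : option L) : omap g o <> None -> o <> None by case: o.
have lm' : Some l <> Some m by case=> /eqP; apply/negP.
have xyl u v : u \in A -> v \in A -> r u = Some l -> r v = Some m ->
    lower u v = lower x y /\ lower v u = lower y x.
  move=> uA vA ru rv.
  have [-> ->] := @block _ _ _ _ _ u x v pm full uA xA vA
    (etrans ru (esym rx)) ltac:(by rewrite ru) ltac:(by rewrite rv)
    ltac:(by rewrite ru rv).
  have [-> ->] := @block _ _ _ _ _ v y x pm full vA yA xA
    (etrans rv (esym ry)) ltac:(by rewrite rv) ltac:(by rewrite rx)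
    ltac:(by rewrite rx rv; apply/nesym).
  by [].
have le_of_bl (S : dendrogram X) (u v : edge S) : lower u v || lower v u ->
    ble (Some u) (Some v) || ble (Some v) (Some u).
  by rewrite ![ble _ _]ble_eqVbelow => /orP[] ->; rewrite !orbT.
have key1 u u1 v : u \in A -> u1 \in A -> v \in A -> r2 u = r2 u1 ->
    r2 u <> None -> r2 v <> None -> r2 u <> r2 v ->
    lower u v = lower u1 v /\ lower v u = lower v u1.
  rewrite !r2E => uA u1A vA ruu1 nu nv nuv.
  have nv' := NN _ nv; have nu' := NN _ nu.
  have nuv' : r u <> r v by move=> E; apply: nuv; rewrite E.
  have nu1v' : r u1 <> r v by move=> E; apply: nuv; rewrite ruu1 E.
  have gx : omap g (Some l) = omap g (Some m).
    by rewrite /g /= eqxx [m == l]eq_sym (negPf lm).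
  have vxy : (r u = Some l \/ r u = Some m) -> v != x /\ v != y.
    have E1 : r u = Some l \/ r u = Some m -> omap g (r u) = omap g (Some m).
      by case=> ->.
    move=> /E1 E; split; apply/eqP => vE; apply: nuv; rewrite E vE ?rx ?ry //.
  case: (sameN _ _ ruu1 nu') => [E|[El Em]|[Em El]].
  - exact: block pm full _ _ _ E nu' nv' nuv'.
  - have [vx vy] := vxy (or_introl El).
    have [-> ->] := @block _ _ _ _ _ u x v pm full uA xA vA
      (etrans El (esym rx)) nu' nv' nuv'.
    have [-> ->] := @block _ _ _ _ _ u1 y v pm full u1A yA vA
      (etrans Em (esym ry)) ltac:(by rewrite Em) nv' nu1v'.
    exact: tw.
  - have [vx vy] := vxy (or_intror Em).
    have [-> ->] := @block _ _ _ _ _ u y v pm full uA yA vA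
      (etrans Em (esym ry)) nu' nv' nuv'.
    have [-> ->] := @block _ _ _ _ _ u1 x v pm full u1A xA vA
      (etrans El (esym rx)) ltac:(by rewrite El) nv' nu1v'.
    by have [-> ->] := tw v vA vx vy.
split.
- move=> u v uA vA; rewrite !r2E => ruv /NN nu.
  case: (sameN _ _ ruv nu) => [E|[Eu Ev]|[Eu Ev]]; first exact: chl.
    by apply: le_of_bl; have [-> ->] := xyl u v uA vA Eu Ev.
  by apply: le_of_bl; have [-> ->] := xyl v u vA uA Ev Eu; rewrite orbC.
- have cmpr u v : u \in A' -> v \in A' -> r' u = Some l -> r' v = Some m ->
      lower u v || lower v u.
    move=> uA vA Eu Ev.
    rewrite -(cons x y u v) ?rx ?ry //.
    by rewrite -(cons y x v u) ?rx ?ry //; apply/nesym.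
  move=> u v uA vA; rewrite !r2E' => ruv /NN nu.
  case: (sameN _ _ ruv nu) => [E|[Eu Ev]|[Eu Ev]]; first exact: chr.
    by apply: le_of_bl; apply: cmpr.
  by rewrite orbC; apply: le_of_bl; apply: cmpr.
- move=> u v u' v' uA vA u'A v'A ru rv nu nv nuv.
  have nu' : r' u' <> None by apply: NN; rewrite -r2E' -ru.
  have nv' : r' v' <> None by apply: NN; rewrite -r2E' -rv.
  have [u1 u1A ru1] := full' u' u'A nu'; have [v1 v1A rv1] := full' v' v'A nv'.
  have r2u : r2 u = r2 u1 by rewrite ru r2E r2E' ru1.
  have r2v : r2 v = r2 v1 by rewrite rv r2E r2E' rv1.
  have [-> _] := key1 u u1 v uA u1A vA r2u nu nv nuv.
  have [_ ->] := key1 v v1 u1 vA v1A u1A r2v nv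
    ltac:(by rewrite -r2u) ltac:(by rewrite -r2u; apply/nesym).
  apply: cons; rewrite // ?ru1 ?rv1 //.
  by move=> E; apply: nuv; rewrite ru rv !r2E' E.
Qed.

End Compatible.
End Labelings.

(** * From edit paths to labellings *)
Section PathToLabelling.
Context {R : realType} {X : editableSpace R}.
Local Notation wtree := (wtree (X := X)).
Local Notation lower u v := (below (Some u) (Some v)).

Section Transport.
Context {S T T' : dendrogram X} (t : wtree (edge T)) (t' : wtree (edge T')).
Context (f : edge S -> edge T).
Hypotheses (it : induced t) (injf : injective f)
  (imf : [set f x | x in edge S]%SET = live t)
  (upf : forall x, up t (f x) = omap f (parent x))
  (wtf : forall x, wt t (f x) = weight x).

Let ft x : f x \in live t. Proof. by rewrite -imf imset_f. Qed.

Let bf x y : lower x y = lower (f x) (f y).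
Proof. exact: iso_below it injf imf upf x y. Qed.

Let lef x y : ble (Some x) (Some y) = ble (Some (f x)) (Some (f y)).
Proof.
by rewrite !ble_eqVbelow bf !eq_Some (inj_eq injf).
Qed.

Lemma compatible_iso (L : finType) r rS (r' : edge T' -> option L) :
  (forall x, r (f x) = rS x) ->
  compatible (live (whole S)) (live t') rS r' <->
  compatible (live t) (live t') r r'.
Proof.
move=> rf; split=> -[chl chr cons]; split=> //.
- move=> u v; rewrite -imf => /imsetP[x _ ->] /imsetP[y _ ->].
  by rewrite !rf -!lef; apply: chl.
- move=> u v u' v'; rewrite -imf => /imsetP[x _ ->] /imsetP[y _ ->].
  by rewrite !rf -!bf; apply: cons.
- by move=> x y _ _; rewrite -!rf !lef; apply: chl.
- by move=> x y u' v' _ _; rewrite -!rf bf; apply: cons.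
Qed.

Lemma fiber_weight_iso (L : finType) r rS : (forall x, r (f x) = rS x) ->
  fiber_weight (whole S) rS = fiber_weight t r :> (option L -> X).
Proof.
move=> rf; apply/funext => o.
rewrite /fiber_weight -imf [RHS]big_mkcondr big_imset /=; last first.
  by move=> x y _ _; apply: injf.
rewrite -big_mkcondr; apply: eq_big => x; rewrite ?inE ?rf //.
Qed.

End Transport.

Lemma labelling_iso (S T T' : dendrogram X) (t : wtree (edge T))
    (t' : wtree (edge T')) c : induced t -> iso S t ->
  labelling_le (whole S) t' c <-> labelling_le t t' c.
Proof.
move=> it [f [injf imf upf wtf]]; split=> -[L [r [r' [rP le_c]]]].
  pose r2 u := if [pick x | f x == u] is Some x then r x else None.
  have r2f x : r2 (f x) = r x.
    by rewrite /r2; case: pickP => [y /eqP/injf->//|/(_ x)]; rewrite eqxx.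
  exists L, r2, r'; split; first exact/(compatible_iso _ it injf imf upf _ r2f).
  by rewrite -(fiber_weight_iso injf imf wtf r2f).
exists L, (r \o f), r'; split.
  exact/(compatible_iso _ it injf imf upf _ (fun=> erefl)).
by rewrite (@fiber_weight_iso _ _ t f injf imf wtf L r (r \o f)).
Qed.

Section Steps.
Context {T T' : dendrogram X} (t' : wtree (edge T')).
Implicit Types (e : edge T) (t : wtree (edge T)).

Lemma sum_at (I : finType) (j : I) (x : R) :
  \sum_(i : I) (if j == i then x else 0) = x.
Proof. by rewrite -big_mkcond (big_pred1 j) // => i; rewrite eq_sym. Qed.

(** Only the product of the class of [e] changes, and the Lipschitz bound
   applies; likewise for deletions and insertions. *)
Lemma labelling_shrink e y c : labelling_le (shrink (whole T) e y) t' c ->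
  labelling_le (whole T) t' (mdist (weight e) y + c).
Proof.
move=> [L [r [r' [rP le_c]]]]; exists L, r, r'; split=> //.
apply: le_trans (mcost_lipschitz _ _ _) _.
apply: lerD (le_c); rewrite -[leRHS](sum_at (r e)); apply: ler_sum => o _.
rewrite (fiber_weightD1 (t := whole T) r (e := e)) //.
rewrite (fiber_weightD1 (t := shrink (whole T) e y) r (e := e)) //=.
have -> : fiber_weight (delete (shrink (whole T) e y) e) r o =
    fiber_weight (delete (whole T) e) r o.
  by apply: eq_bigr => u /=; rewrite in_setD1 => /andP[/andP[/negPf->]].
by rewrite mdist_eopr eqxx; case: ifP; rewrite ?mdistxx.
Qed.

Lemma labelling_delete e c : labelling_le (delete (whole T) e) t' c ->
  labelling_le (whole T) t' (mdist (weight e) ezero + c).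
Proof.
move=> [L [r [r' [[chl chr cons] le_c]]]].
pose r2 u := if u == e then None else r u.
have r2e : r2 e = None by rewrite /r2 eqxx.
have r2N u : r2 u <> None -> u \in live (delete (whole T) e) /\ r2 u = r u.
  by rewrite /r2 in_setD1 in_whole; case: eqP.
exists L, r2, r'; split.
  split=> // [u v _ _ ruv nu|u v u' v' _ _ u'A v'A ru rv nu nv nuv].
    have nv : r2 v <> None by rewrite -ruv.
    have [uA ru] := r2N u nu; have [vA rv] := r2N v nv.
    by apply: chl; rewrite // -?ru -?rv.
  have [uA ru2] := r2N u nu; have [vA rv2] := r2N v nv.
  by apply: cons; rewrite // -?ru2 -?rv2.
apply: le_trans (mcost_lipschitz (fiber_weight (delete (whole T) e) r) _ _) _.
apply: lerD (le_c); rewrite -[leRHS](sum_at (r2 e)); apply: ler_sum => o _.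
rewrite (fiber_weightD1 (t := whole T) r2 (e := e)) //=.
have -> : fiber_weight (delete (whole T) e) r2 o =
    fiber_weight (delete (whole T) e) r o.
  by apply: eq_bigl => u /=; rewrite in_setD1 /r2; case: eqP.
by rewrite mdist_absorb; case: ifP; rewrite ?norm0.
Qed.

Lemma labelling_insert e c : labelling_le (whole T) t' c ->
  labelling_le (delete (whole T) e) t' (mdist (weight e) ezero + c).
Proof.
move=> [L [r [r' [rP le_c]]]]; exists L, r, r'; split.
  by apply: compatibleS rP; apply: subD1set.
apply: le_trans (mcost_lipschitz (fiber_weight (whole T) r) _ _) _.
apply: lerD (le_c); rewrite -[leRHS](sum_at (r e)); apply: ler_sum => o _.
rewrite (fiber_weightD1 (t := whole T) r (e := e)) //= metric_sym mdist_absorb.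
by case: ifP; rewrite ?norm0.
Qed.

(** An edge strictly below [e] is below its only child [c], and nothing lies
   between [c] and [e]. *)
Lemma only_child_twins t e c : induced t -> e \in live t ->
  [set u in live t | up t u == Some e] = [set c]%SET -> twins (live t) e c.
Proof.
move=> it et chE.
have /setIdP[ct /eqP upc] : c \in [set u in live t | up t u == Some e].
  by rewrite chE set11.
have [ce _ cnear] := it c ct; rewrite upc in ce.
have only v : v \in live t -> lower v e -> ble (Some v) (Some c).
  move=> vt ve; have [c' c't [upc' vc']] := child_above it vt et ve.
  suff <- : c' = c by [].
  by apply/set1P; rewrite -chE inE c't upc' eqxx.
split=> //.
- by apply: contraTneq ce => ->; apply: below_irr.
- by rewrite ce orbT.
move=> v vt ve vc; split; apply/idP/idP.
- exact: below_trans ce.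
- move/(cnear v vt); rewrite upc ble_eqVbelow eq_Some.
  by rewrite eq_sym (negPf ve).
- by move/(only v vt); rewrite ble_eqVbelow eq_Some (negPf vc).
- by move/below_trans; apply.
Qed.

Lemma degree2_child t e : degree2 t e ->
  exists c, [set u in live t | up t u == Some e] = [set c]%SET.
Proof. by case/andP=> _ /cards1P. Qed.

(** Label [e] like its only child: the merged edge of the ghosted tree has the
   product of the two weights, so that the costs agree. *)
Lemma labelling_ghost e c : degree2 (whole T) e ->
  labelling_le (ghost (whole T) e) t' c -> labelling_le (whole T) t' c.
Proof.
move=> /degree2_child[d dE] [L [r [r' [rP le_c]]]].
have tw : twins (live (whole T)) e d.
  by apply: only_child_twins dE; [exact: induced_whole|].
have [_ _ ed _ _] := tw.
exists L, (fun u => r (if u == e then d else u)), r'.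
split; first exact: (compatible_twin tw).
apply: le_trans le_c; rewrite le_eqVlt; apply/orP; left; apply/eqP.
congr mcost; apply/funext => o.
rewrite -(@fiber_weight_ghost _ _ _ _ (whole T) _ e d) ?eqxx //;
  [|by rewrite eq_sym|by rewrite [d == e]eq_sym (negPf ed)].
by apply: eq_bigl => u /=; rewrite in_setD1; case: eqP.
Qed.

(** The norm of the weight of [x] is saved among the deleted edges and pays for
   multiplying the class of [y] by this weight. *)
Lemma mcost_undelete (L : finType) t r x y (B : option L -> X) :
  x \in live t -> x != y -> r x = None ->
  mcost (fiber_weight t (fun u => r (if u == x then y else u))) B <=
  mcost (fiber_weight t r) B.
Proof.
move=> xt xy rx; case ry: (r y) => [l|]; last first.
  rewrite (_ : (fun u => r (if u == x then y else u)) = r) //.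
  by apply/funext => u; case: eqP => [->|//]; rewrite rx ry.
set r2 := fun u => r _.
have E1 o : fiber_weight (delete t x) r2 o = fiber_weight (delete t x) r o.
  by apply: eq_bigl => u /=; rewrite in_setD1 /r2; case: eqP.
have r2x : r2 x = Some l by rewrite /r2 eqxx.
have D1 o := fiber_weightD1 r o xt; have D2 o := fiber_weightD1 r2 o xt.
rewrite /mcost (D1 None) (D2 None) rx r2x eqxx /= E1 eop0x normD.
have le_sum : \sum_(a : L) mdist (fiber_weight t r2 (Some a)) (B (Some a)) <=
    norm (wt t x) + \sum_(a : L) mdist (fiber_weight t r (Some a)) (B (Some a)).
  have <- : \sum_(a : L) (if l == a then norm (wt t x) else 0) = norm (wt t x).
    exact: sum_at.
  rewrite -big_split /=; apply: ler_sum => a _.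
  rewrite D1 D2 E1 rx r2x /= eop0x (_ : (Some l == Some a) = (l == a)) //.
  case: ifP => _; last by rewrite eop0x add0r.
  rewrite -(mdist_absorb _ (fiber_weight (delete t x) r (Some a))).
  exact: metric_triangle.
lra.
Qed.

(** A deleted twin takes the label of the other one; two distinct labels are
   merged in both trees. *)
Lemma equalize_labels x y c t : twins (live t) x y -> tight_le t t' c ->
  exists (L : finType) r r', [/\ @compatible _ _ T T' L (live t) (live t') r r',
    r x = r y & mcost (fiber_weight t r) (fiber_weight t' r') <= c].
Proof.
move=> tw [L [r [r' [rP full full' le_c]]]]; have [xt yt xy _ _] := tw.
case rx: (r x) => [l|]; last first.
  exists L, (fun u => r (if u == x then y else u)), r'; split.
  - by apply: compatible_twin tw _; apply: compatibleS rP; apply: subD1set.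
  - by rewrite eqxx [y == x]eq_sym (negPf xy).
  - by apply: le_trans le_c; apply: mcost_undelete.
case ry: (r y) => [m|]; last first.
  have yx : y != x by rewrite eq_sym.
  exists L, (fun u => r (if u == y then x else u)), r'; split.
  - apply: compatible_twin (twins_sym tw) _.
    by apply: compatibleS rP; apply: subD1set.
  - by rewrite eqxx (negPf xy).
  - by apply: le_trans le_c; apply: mcost_undelete.
case: (eqVneq l m) => [lm|lm].
  by exists L, r, r'; split; rewrite ?rx ?ry ?lm.
pose h a := Some (if a == l then m else a).
exists L, (obind h \o r), (obind h \o r'); split.
- exact: compatible_merge rP full full' tw rx ry lm.
- by rewrite /= rx ry /= /h eqxx [m == l]eq_sym (negPf lm).
- apply: le_trans le_c.
  exact: mcost_fiber_relabel.
Qed.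

Lemma labelling_split e c : degree2 (whole T) e ->
  tight_le (whole T) t' c -> labelling_le (ghost (whole T) e) t' c.
Proof.
move=> /degree2_child[d dE] m.
have tw : twins (live (whole T)) e d.
  by apply: only_child_twins dE; [exact: induced_whole|].
have [_ _ ed _ _] := tw.
have [L [r [r' [rP red le_c]]]] := equalize_labels tw m.
exists L, r, r'; split; first by apply: compatibleS rP; apply: subD1set.
apply: le_trans le_c; rewrite le_eqVlt; apply/orP; left; apply/eqP.
congr mcost; apply/funext => o.
by apply: fiber_weight_ghost dE red => //; rewrite eq_sym.
Qed.

End Steps.

Lemma path_labelling (T T' : dendrogram X) (g : edit_path T T') :
  tight_le (whole T) (whole T') (path_cost g).
Proof.
apply: tighten; elim: g => /= [{}T {}T' TT'|{}T T1 {}T' s g IH].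
  apply/(labelling_iso _ _ (@induced_whole _ _ T') TT').
  (* each edge is its own label *)
  exists (edge T'), Some, Some; split.
    split=> [u v _ _ [->]|u v _ _ [->]|u v u' v' _ _ _ _ [->] [->]] //;
      by rewrite ble_refl.
  have none : fiber_weight (whole T') Some None = ezero :> X.
    by rewrite /fiber_weight big_pred0 // => u; rewrite andbF.
  by rewrite /mcost none norm0 !add0r big1 // => a _; rewrite mdistxx.
have iD (S : dendrogram X) (e : edge S) : induced (delete (whole S) e).
  by apply: induced_delete => //; apply: induced_whole.
have iG (S : dendrogram X) (e : edge S) : induced (ghost (whole S) e).
  by apply: induced_ghost => //; apply: induced_whole.
case: s => [e y y0 i|e i|e i|e d i|e d i] /=; rewrite ?add0r.
- by apply: labelling_shrink; apply/(labelling_iso _ _ _ i) => // u;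
    apply: induced_whole.
- by apply: labelling_delete; apply/(labelling_iso _ _ _ i).
- by apply/(labelling_iso _ _ _ i) => //; apply: labelling_insert.
- by apply: labelling_ghost d _; apply/(labelling_iso _ _ _ i).
- apply/(labelling_iso _ _ _ i) => //.
  by apply: labelling_split d _; apply: tighten.
Qed.

End PathToLabelling.

(** * Sequences of deletions and ghostings *)
Section Sequences.
Context {R : realType} {X : editableSpace R} {T : dendrogram X}.
Implicit Types (t : wtree (X := X) (edge T)) (e g : edge T) (s : seq (edge T)).

Definition children t e := [set u in live t | up t u == Some e].

Lemma foldl_delete s t : uniq s -> {subset s <= live t} -> induced t ->
  [/\ induced (foldl (@delete R X _) t s),
      live (foldl (@delete R X _) t s) = live t :\: [set e in s]%SET &
      wt (foldl (@delete R X _) t s) = wt t].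
Proof.
elim: s t => [|e s IH] t /=; first by rewrite finset.set_nil finset.setD0.
case/andP=> es us st it; have et : e \in live t by apply: st; rewrite inE eqxx.
have st' : {subset s <= live (delete t e)}.
  move=> u su; rewrite /= in_setD1 st ?inE ?su ?orbT // andbT.
  by apply: contraNneq es => <-.
have [iF -> ->] := IH (delete t e) us st' (induced_delete it et).
by split=> //; rewrite finset.set_cons finset.setDDl.
Qed.

(** The clause on [r] is what keeps the product of each label class unchanged
   when [s] is ghosted; a constant [r] leaves only the degree condition. *)
Definition ghostable (L : eqType) (r : edge T -> L) t s :=
  {in s, forall g, g \in live t /\
    exists2 c, children t g = [set c]%SET & r c = r g}.

Lemma ghostable_degree2 (L : eqType) (r : edge T -> L) t s g :
  ghostable r t s -> g \in s -> degree2 t g.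
Proof.
by move=> gs /gs[gt [c chE _]]; rewrite /degree2 gt -/(children t g) chE cards1.
Qed.

(** Ghosting [g] affects the children of [h] only if [g] was the only child of
   [h]; then the only child of [g] replaces it. *)
Lemma ghostable_ghost (L : eqType) (r : edge T -> L) t g s :
  induced t -> g \notin s -> ghostable r t (g :: s) ->
  ghostable r (ghost t g) s.
Proof.
move=> it gs ok h hs; have hg : h != g by apply: contraNneq gs => <-.
have [ht [c chE rc]] := ok h (mem_behead (s := g :: s) hs).
have [gt [d dE rd]] := ok g (mem_head _ _).
split; first by rewrite /= in_setD1 hg.
have inC u : (u \in live t) && (up t u == Some h) = (u == c).
  by have /setP/(_ u) := chE; rewrite !inE.
have inD u : (u \in live t) && (up t u == Some g) = (u == d).
  by have /setP/(_ u) := dE; rewrite !inE.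
case: (eqVneq c g) => [cg|cg].
  have upg : up t g = Some h by move: (inC g); rewrite cg eqxx => /andP[_ /eqP].
  exists d; last by rewrite rd -rc cg.
  apply/setP=> u; rewrite !inE /= -inD upg.
  case: (eqVneq (up t u) (Some g)) => [ug|ug]; rewrite ?eqxx ?andbT ?andbF.
    case: (eqVneq u g) => [ugE|//]; move: (up_neq it gt).
    by rewrite -{1}ugE ug eqxx.
  by apply/negbTE; rewrite -andbA inC cg; case: eqP.
exists c => //; apply/setP=> u; rewrite !inE /= -inC.
case: (eqVneq (up t u) (Some g)) => [ug|ug].
  have -> : (up t g == Some h) = false.
    by move: (inC g); rewrite gt /= [g == c]eq_sym (negPf cg).
  rewrite ug andbF (_ : (Some g == Some h) = (g == h)) //.
  by rewrite eq_sym (negPf hg) andbF.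
case: (eqVneq u g) => [->|//]; rewrite /= gt.
by move: (inC g); rewrite gt /= [g == c]eq_sym (negPf cg).
Qed.

Lemma foldl_ghost (L : finType) (r : edge T -> option L) s t :
  uniq s -> ghostable r t s -> induced t ->
  [/\ induced (foldl (@ghost R X _) t s),
      live (foldl (@ghost R X _) t s) = live t :\: [set e in s]%SET &
      fiber_weight (foldl (@ghost R X _) t s) r =1 fiber_weight t r].
Proof.
elim: s t => [|g s IH] t /=; first by rewrite finset.set_nil finset.setD0.
case/andP=> gs us ok it; have [gt [c chE rc]] := ok g (mem_head _ _).
have [iF -> fw] := IH (ghost t g) us (ghostable_ghost it gs ok)
  (induced_ghost it gt).
split=> // [|o]; first by rewrite finset.set_cons finset.setDDl.
rewrite fw; apply: (fiber_weight_ghost _ gt _ chE) => //.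
have /setIdP[ct upc] : c \in children t g by rewrite chE set11.
by apply: contraTneq upc => ->; apply: up_neq.
Qed.

End Sequences.

(** * Sequences of edits as paths *)
Section EditSequences.
Context {R : realType} {X : editableSpace R} {T : dendrogram X}.
Implicit Types (t : wtree (X := X) (edge T)) (e g : edge T) (s : seq (edge T))
  (S : dendrogram X).

Definition nonzero t := {in live t, forall u, wt t u != ezero}.

Lemma iso_edge S t e : iso S t -> e \in live t ->
  exists f x, wiso f (whole S) t /\ e = f x.
Proof.
move=> /iso_wiso[f fP] et; have [_ imf _ _] := fP.
by move: et; rewrite -imf => /imsetP[x _ ex]; exists f, x.
Qed.

Lemma edit_delete S S1 t e : e \in live t -> iso S t -> iso S1 (delete t e) ->
  exists s : edit S S1, edit_cost s = norm (wt t e).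
Proof.
move=> et /iso_edge-/(_ _ et)[f [x [fP ->]]] i1.
exists (Delete ((iso_delete _ _ fP).1 i1)) => /=.
by have [_ _ _ ->] := fP.
Qed.

Lemma edit_ghost S S1 t e : degree2 t e -> iso S t -> iso S1 (ghost t e) ->
  exists s : edit S S1, edit_cost s = 0.
Proof.
move=> d2; have /andP[et _] := d2.
move=> /iso_edge-/(_ _ et)[f [x [fP ex]]] i1; rewrite ex in d2 i1.
have d2' : degree2 (whole S) x by rewrite -(degree2_iso _ fP).
by exists (Ghost d2' ((iso_ghost _ _ fP).1 i1)).
Qed.

Lemma edit_shrink S S1 t e y : e \in live t -> y != ezero ->
  iso S t -> iso S1 (shrink t e y) ->
  exists s : edit S S1, edit_cost s = mdist (wt t e) y.
Proof.
move=> et y0 /iso_edge-/(_ _ et)[f [x [fP ->]]] i1.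
exists (Shrink y0 ((iso_shrink _ _ _ fP).1 i1)) => /=.
by have [_ _ _ ->] := fP.
Qed.

Lemma eop_neq0 (x y : X) : x != ezero -> eop x y != ezero.
Proof.
move=> x0; rewrite -mdist_gt0 -/(norm _) normD ltr_wpDr ?norm_ge0 //.
by rewrite mdist_gt0.
Qed.

Lemma nonzero_ghost t e : nonzero t -> nonzero (ghost t e).
Proof.
move=> nz u /= /setD1P[_ ut]; case: ifP => _; last exact: nz.
exact/eop_neq0/nz.
Qed.

Lemma costs_delete_all s t S S' : uniq s -> {subset s <= live t} ->
  induced t -> nonzero t -> iso S t -> iso S' (foldl (@delete R X _) t s) ->
  path_costs S S' (\sum_(e <- s) norm (wt t e)).
Proof.
elim: s t S => [|e s IH] t S /=.
  by move=> _ _ _ _ St S't; rewrite big_nil; apply/costs_stop/(iso_common St).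
case/andP=> es us st it nz St S't.
have et : e \in live t by apply: st; rewrite inE eqxx.
have nz1 : nonzero (delete t e) by move=> u /setD1P[_]; apply: nz.
have [S1 S1t] := realize (induced_delete it et) nz1.
have [d dE] := edit_delete et St S1t; rewrite big_cons -dE.
apply: costs_step; rewrite -[wt t]/(wt (delete t e)).
apply: IH S1t S't => //; last exact: induced_delete.
move=> u su; rewrite /= in_setD1 st ?inE ?su ?orbT // andbT.
by apply: contraNneq es => <-.
Qed.

Lemma costs_ghost_all (L : finType) (r : edge T -> option L) s t S S' :
  uniq s -> ghostable r t s ->
  induced t -> nonzero t -> iso S t -> iso S' (foldl (@ghost R X _) t s) ->
  path_costs S S' 0.
Proof.
elim: s t S => [|e s IH] t S /=.
  by move=> _ _ _ _ St S't; apply/costs_stop/(iso_common St).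
case/andP=> es us ok it nz St S't.
have d2 := ghostable_degree2 ok (mem_head _ _); have /andP[et _] := d2.
have [S1 S1t] := realize (induced_ghost it et) (nonzero_ghost nz).
have [d d0] := edit_ghost d2 St S1t.
rewrite -[0]addr0 -{1}d0; apply: costs_step; apply: IH S1t S't => //.
- exact: ghostable_ghost.
- exact: induced_ghost.
- exact: nonzero_ghost.
Qed.

Lemma nonzero_ghost_all s t : nonzero t ->
  nonzero (foldl (@ghost R X _) t s).
Proof. by elim: s t => //= e s IH t nz; apply/IH/nonzero_ghost. Qed.

Lemma costs_reweight (w : edge T -> X) s t S S' :
  uniq s -> {subset s <= live t} -> induced t -> nonzero t ->
  {in live t, forall u, w u != ezero} -> iso S t ->
  iso S' (WTree (live t) (up t) (fun u => if u \in s then w u else wt t u)) ->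
  path_costs S S' (\sum_(e <- s) mdist (wt t e) (w e)).
Proof.
elim: s t S => [|e s IH] t S /=.
  move=> _ _ _ _ _ St S't; rewrite big_nil; apply/costs_stop/(iso_common St).
  exact: S't.
case/andP=> es us st it nz w0 St S't.
have et : e \in live t by apply: st; rewrite inE eqxx.
have nz1 : nonzero (shrink t e (w e)).
  by move=> u ut /=; case: (u =P e) => _; [apply: w0|apply: nz].
have it1 : induced (shrink t e (w e)) by exact: it.
have [S1 S1t] := realize it1 nz1.
have [d dE] := edit_shrink et (w0 _ et) St S1t; rewrite big_cons -dE.
apply: costs_step.
have -> : \sum_(u <- s) mdist (wt t u) (w u) =
    \sum_(u <- s) mdist (wt (shrink t e (w e)) u) (w u).
  apply: eq_big_seq => u su /=; case: eqP => // ue.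
  by rewrite -ue su in es.
apply: IH S1t _ => //.
  by move=> u su; apply: st; rewrite inE su orbT.
rewrite (_ : (fun u => _) = (fun u => if u \in e :: s then w u else wt t u)) //.
apply/funext => u /=; rewrite inE; case: (eqVneq u e) => [->|//].
by rewrite (negPf es).
Qed.

End EditSequences.

(** * From mappings to edit paths *)
Section MappingToPath.
Context {R : realType} {X : editableSpace R}.
Local Notation wtree := (wtree (X := X)).
Local Notation lower u v := (below (Some u) (Some v)).

(** A converse of [iso_below]: in an induced tree, the parent of an edge is the
   lowest vertex strictly above it, and the order knows which one this is. *)
Lemma up_embedding (T S : dendrogram X) (t : wtree (edge T))
    (g : edge S -> edge T) :
  induced t -> [set g x | x in edge S]%SET = live t ->
  (forall x y, lower x y = lower (g x) (g y)) ->
  forall x, up t (g x) = omap g (parent x).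
Proof.
move=> it img bg x; have gt y : g y \in live t by rewrite -img imset_f.
have [gup liveup _] := it _ (gt x).
apply: ble_anti.
  apply: nearest_ble => // [v|].
    by case: (parent x) => [y|//] [<-].
  have : below (Some x) (parent x) by rewrite belowE.
  by case: (parent x) => [y|] /=; [rewrite bg|rewrite !belowE].
case E: (up t (g x)) liveup gup => [v|] // liveup.
have /imsetP[y _ ->] : v \in [set g x | x in edge S]%SET by rewrite img liveup.
rewrite -bg belowE; case: (parent x) => [z|]; last by rewrite ble_None.
rewrite ble_eqVbelow => /orP[/eqP[->]|]; first exact: ble_refl.
by rewrite bg; apply: below_ble.
Qed.

Section OneSide.
Context (T : dendrogram X) (D G : {set edge T}).

Lemma costs_reduce (L : finType) (r : edge T -> option L) (S : dendrogram X) :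
  ghostable r (delete_all (whole T) D) (enum G) ->
  iso S (ghost_all (delete_all (whole T) D) G) ->
  path_costs T S (\sum_(v in D) norm (weight v)).
Proof.
move=> ok St.
have [||it _ wtE] := @foldl_delete _ _ T (enum D) (whole T) (enum_uniq _).
- by move=> u _; exact: in_whole.
- exact: induced_whole.
have nz : nonzero (delete_all (whole T) D).
  by move=> u _; rewrite /delete_all wtE; apply: weight_neq0.
have [S1 S1t] := realize it nz.
rewrite -[X in path_costs _ _ X]addr0 -[X in path_costs _ _ (X + _)]big_enum.
apply: costs_trans (costs_ghost_all (enum_uniq _) ok it nz S1t St).
apply: (costs_delete_all _ _ (@induced_whole _ _ T)) S1t => //.
- exact: enum_uniq.
- by move=> u _; exact: in_whole.
- by move=> u _; exact: weight_neq0.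
- exact: dendro_iso_refl.
Qed.

End OneSide.

(** The coupled pairs give an order isomorphism between the live edges of the two
   reduced trees, hence by [up_embedding] an isomorphism of trees. *)
Lemma mapping_costs (T T' : dendrogram X) (M : {set prepairs T T'}) :
  mapping M -> path_costs T T' (map_cost M).
Proof.
move=> mM.
have okl : ghostable (fun=> @None unit) (prunedl M) (enum (ghostedl M)).
  move=> g; rewrite mem_enum inE => /(map_ghostl mM) d2.
  have [c cE] := degree2_child d2; have /andP[gt _] := d2.
  by split=> //; exists c.
have okr : ghostable (fun=> @None unit) (prunedr M) (enum (ghostedr M)).
  move=> g; rewrite mem_enum inE => /(map_ghostr mM) d2.
  have [c cE] := degree2_child d2; have /andP[gt _] := d2.
  by split=> //; exists c.
have [||ipl lpl wpl] := @foldl_delete _ _ T (enum (deletedl M)) (whole T)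
  (enum_uniq _);
  [by move=> u _; exact: in_whole|exact: induced_whole|].
have [||ipr lpr wpr] := @foldl_delete _ _ T' (enum (deletedr M)) (whole T')
  (enum_uniq _);
  [by move=> u _; exact: in_whole|exact: induced_whole|].
have [irl lrl _] := foldl_ghost (enum_uniq _) okl ipl.
have [irr lrr _] := foldl_ghost (enum_uniq _) okr ipr.
rewrite -/(reducedl M) in irl lrl; rewrite -/(reducedr M) in irr lrr.
have nzl : nonzero (reducedl M).
  apply: nonzero_ghost_all => u _; rewrite /prunedl /delete_all wpl.
  exact: weight_neq0.
have nzr : nonzero (reducedr M).
  apply: nonzero_ghost_all => u _; rewrite /prunedr /delete_all wpr.
  exact: weight_neq0.
have uniql v p q : (inl v, p) \in M -> (inl v, q) \in M -> p = q.
  by have [x [_ xU]] := map_uniql mM v => /xU <- /xU <-.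
have uniqr w p q : (p, inl w) \in M -> (q, inl w) \in M -> p = q.
  by have [x [_ xU]] := map_uniqr mM w => /xU <- /xU <-.
have livel v : v \in live (reducedl M) <-> exists w, (inl v, inl w) \in M.
  rewrite lrl /prunedl /delete_all lpl !inE !mem_enum !inE andbT.
  split=> [|[w vw]].
    have [[w|[]] [vw _]] := map_uniql mM v; last by rewrite vw.
      by exists w.
    by rewrite vw andbF.
  by apply/andP; split; apply/negP => /(uniql _ _ _ vw).
have liver w : w \in live (reducedr M) <-> exists v, (inl v, inl w) \in M.
  rewrite lrr /prunedr /delete_all lpr !inE !mem_enum !inE andbT.
  split=> [|[v vw]].
    have [[v|[]] [vw _]] := map_uniqr mM w; last by rewrite vw.
      by exists v.
    by rewrite vw andbF.
  by apply/andP; split; apply/negP => /(uniqr _ _ _ vw).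
have [S Sl] := realize irl nzl; have [S' S'r] := realize irr nzr.
have cl := costs_reduce okl Sl; have cr := costs_sym (costs_reduce okr S'r).
(* the weight of the partner; the default is never met on live edges *)
pose w2 v := if [pick w | (inl v, inl w) \in M] is Some w
  then wt (reducedr M) w else ezero.
have w2E v w : (inl v, inl w) \in M -> w2 v = wt (reducedr M) w.
  rewrite /w2 => vw; case: pickP => [w' vw'|/(_ w)]; last by rewrite vw.
  by have [->] := uniql _ _ _ vw vw'.
have w20 : {in live (reducedl M), forall v, w2 v != ezero}.
  move=> v /livel[w vw]; rewrite (w2E _ _ vw); apply: nzr.
  by apply/liver; exists v.
have S'w : iso S' (WTree (live (reducedl M)) (up (reducedl M))
    (fun u => if u \in enum (live (reducedl M)) then w2 u
              else wt (reducedl M) u)).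
  have [f [injf imf upf wtf]] := S'r.
  have fr x : f x \in live (reducedr M) by rewrite -imf imset_f.
  have /choice[g gP] x : exists v, (inl v, inl (f x)) \in M by exact/liver.
  have gl x : g x \in live (reducedl M) by apply/livel; exists (f x).
  have img : [set g x | x in edge S']%SET = live (reducedl M).
    apply/setP=> v; apply/imsetP/idP => [[x _ ->]//|/livel[w vw]].
    have : w \in live (reducedr M) by apply/liver; exists v.
    rewrite -imf => /imsetP[x _ wx]; exists x => //.
    by rewrite wx in vw; have [] := uniqr _ _ _ vw (gP x).
  exists g; split=> //=.
  - move=> x y gxy; apply: injf; have := gP x; rewrite gxy => H.
    by have [] := uniql _ _ _ H (gP y).
  - apply: up_embedding => // x y.
    rewrite (iso_below irr injf imf upf).
    by apply/idP/idP => /(map_order mM (gP y) (gP x)).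
  - by move=> x; rewrite mem_enum gl (w2E _ _ (gP x)).
have sub : {subset enum (live (reducedl M)) <= live (reducedl M)}.
  by move=> v; rewrite mem_enum.
have cs := costs_reweight (enum_uniq _) sub irl nzl w20 Sl S'w.
have -> : map_cost M = \sum_(v in deletedl M) norm (weight v) +
    (\sum_(e <- enum (live (reducedl M))) mdist (wt (reducedl M) e) (w2 e) +
     \sum_(w in deletedr M) norm (weight w)).
  rewrite /map_cost -addrA; congr (_ + _); rewrite addrC; congr (_ + _).
  rewrite big_enum /= (_ : live (reducedl M) = [set p.1 | p in coupled M]%SET).
    rewrite big_imset /=.
      by apply: eq_bigr => -[v w]; rewrite inE /= => /w2E ->.
    move=> [v w] [v' w']; rewrite !inE /= => vw v'w' vv'.
    by rewrite vv' in vw *; have [->] := uniql _ _ _ vw v'w'.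
  apply/setP=> v; apply/idP/imsetP => [/livel[w vw]|[[v' w] + ->]].
    by exists (v, w); rewrite ?inE.
  by rewrite inE => vw; apply/livel; exists w.
exact: costs_trans cl (costs_trans cs cr).
Qed.

End MappingToPath.

(** * From labellings to mappings *)
Section LabellingToMapping.
Context {R : realType} {X : editableSpace R}.
Local Notation lower u v := (below (Some u) (Some v)).

Lemma compatible_sym (T T' : dendrogram X) (L : finType) (A : {set edge T})
    (A' : {set edge T'}) (r : edge T -> option L) (r' : edge T' -> option L) :
  compatible A A' r r' -> compatible A' A r' r.
Proof.
move=> [chl chr cons]; split=> // u v u' v' uA vA u'A v'A ru rv nu nv nuv.
by rewrite (cons u' v' u v) // -?ru -?rv.
Qed.

Section OneSide.
Context {T T' : dendrogram X} {L : finType} (r : edge T -> option L)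
  (r' : edge T' -> option L).

(** Ghosting merges an edge into the one below it, so the lowest edge of a class
   is the one that survives. *)
Definition bottom u :=
  (r u != None) && [forall v, (r v == r u) ==> ~~ lower v u].
Definition unlabelled := [set v | r v == None]%SET.
Definition non_bottom := [set v | (r v != None) && ~~ bottom v]%SET.

Local Notation pruned := (delete_all (whole T) unlabelled).

Lemma pruned_spec : [/\ induced pruned,
  forall v, (v \in live pruned) = (r v != None) & wt pruned = weight].
Proof.
have [||it lt wtE] := @foldl_delete _ _ T (enum unlabelled) (whole T)
  (enum_uniq _);
  [by move=> u _; exact: in_whole|exact: induced_whole|].
split=> // v; rewrite /delete_all lt !inE mem_enum inE andbT.
by case: (r v).
Qed.

(** Take an edge of the class with the fewest edges of [T] below it. *)
Lemma bottom_exists u : r u <> None -> exists2 v, bottom v & r v = r u.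
Proof.
move=> nu; case: (@arg_minnP _ u (fun v => r v == r u)
  (fun v => #|[set w | lower w v]%SET|) (eqxx _)) => v /eqP rv vmin.
exists v => //; rewrite /bottom rv; apply/andP; split; first exact/eqP.
apply/forallP=> w; apply/implyP=> /eqP rw; apply/negP=> wv.
have := vmin w; rewrite rw eqxx => /(_ isT); rewrite leqNgt => /negP[].
apply: proper_card; apply/properP; split.
  by apply/fintype.subsetP => z; rewrite !inE => /below_trans; apply.
by exists w; rewrite !inE // (negPf (below_irr _)).
Qed.

Hypotheses (pm : compatible [set: edge T]%SET [set: edge T']%SET r r')
  (full : sublabels [set: edge T]%SET [set: edge T']%SET r r').

Lemma comparable_labels u v : r u = r v -> r u <> None ->
  [\/ u = v, lower u v | lower v u].
Proof.
move=> ruv nu; have := chainl pm (finset.in_setT u) (finset.in_setT v) ruv nu.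
rewrite !ble_eqVbelow !eq_Some => /orP[]/orP[].
- by move/eqP=> ->; constructor 1.
- by constructor 2.
- by move/eqP=> ->; constructor 1.
- by constructor 3.
Qed.

Lemma bottom_uniq u v : bottom u -> bottom v -> r u = r v -> u = v.
Proof.
move=> /andP[/eqP nu /forallP mu] /andP[_ /forallP mv] ruv.
case: (comparable_labels ruv nu) => // [uv|vu].
  by have := mv u; rewrite ruv eqxx uv.
by have := mu v; rewrite ruv eqxx vu.
Qed.

(** Some edge of the class of [g] lies below [g]; the child [c] of [g] above it
   has the same label, as classes are not interleaved ([block]).  Any other
   child of [g] would be incomparable with [c], which contradicts the chain
   condition if it has the label of [g], and otherwise [block] again, since it
   is below [g]. *)
Lemma ghostable_blocks : ghostable r pruned (enum non_bottom).
Proof.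
have [it lE _] := pruned_spec.
move=> g; rewrite mem_enum inE => /andP[ng bg]; split; first by rewrite lE.
have [w rw wg] : exists2 w, r w = r g & lower w g.
  move: bg; rewrite /bottom ng /= => /forallPn[w].
  by rewrite negb_imply negbK => /andP[/eqP]; exists w.
have [||c ct [upc wc]] := child_above it _ _ wg; rewrite ?lE ?rw //.
have cg : lower c g by have [+ _ _] := it c ct; rewrite upc.
have nc : r c <> None by move: ct; rewrite lE => /eqP.
have nw : r w <> None by rewrite rw; apply/eqP.
have rc : r c = r g.
  case: (eqVneq (r c) (r g)) => // /eqP ncg; exfalso.
  (* otherwise [c], being below [g], would by [block] be below [w] too *)
  have ncw : r w <> r c by rewrite rw; apply/nesym.
  have [_ e] := block pm full (finset.in_setT w) (finset.in_setT g)
    (finset.in_setT c) rw nw nc ncw.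
  by have := below_ble_trans (etrans e cg : lower c w) wc; apply/negP/below_irr.
exists c => //; apply/setP=> u; rewrite !inE.
apply/andP/eqP => [[ut /eqP upu]|->]; last by rewrite upc.
have ug : lower u g by have [+ _ _] := it u ut; rewrite upu.
have gt : g \in live pruned by rewrite lE.
have nu : r u <> None by move: ut; rewrite lE => /eqP.
have notuc : ~ lower u c.
  move=> uc; have [_ _ /(_ c ct uc)] := it u ut.
  rewrite upu => gc; have := below_ble_trans cg gc.
  by apply/negP/below_irr.
have notcu : ~ lower c u.
  move=> cu; have [_ _ /(_ u ut cu)] := it c ct.
  rewrite upc => gu; have := below_ble_trans ug gu.
  by apply/negP/below_irr.
case: (eqVneq (r u) (r g)) => [rug|/eqP nug].
  by case: (comparable_labels (etrans rug (esym rc)) nu).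
exfalso; apply: notuc.
have ncu : r c <> r u by rewrite rc; apply/nesym.
by have [_ ->] := block pm full (finset.in_setT c) (finset.in_setT g)
  (finset.in_setT u) rc nc nu ncu.
Qed.

(** Ghosting preserves the product of each class, and in the end the class is
   reduced to its lowest edge. *)
Lemma wt_bottom v : bottom v ->
  wt (ghost_all pruned non_bottom) v = fiber_weight (whole T) r (r v).
Proof.
move=> bv; have [it lE wE] := pruned_spec; have /andP[nv _] := bv.
have [_ lg fw] := foldl_ghost (enum_uniq _) ghostable_blocks it.
have -> : fiber_weight (whole T) r (r v) = fiber_weight pruned r (r v).
  rewrite /fiber_weight wE; apply: eq_bigl => u; rewrite lE inE /=.
  by case: (eqVneq (r u) (r v)) => [->|]; rewrite ?nv ?andbF.
rewrite -fw /fiber_weight (big_pred1 v) // => u.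
rewrite lg !inE mem_enum inE lE.
apply/andP/eqP => [[/andP[+ nu]] /eqP ruv|->].
  by rewrite nu /= negbK => bu; apply: bottom_uniq.
by rewrite eqxx nv bv.
Qed.

End OneSide.

(** Two lowest edges with the same label are coupled.  That every lowest edge has
   a partner is where the absence of one-sided labels is used. *)
Lemma labelling_mapping (T T' : dendrogram X) c :
  tight_le (whole T) (whole T') c ->
  exists2 M : {set prepairs T T'}, mapping M & map_cost M <= c.
Proof.
move=> [L [r [r' [pm full full' le_c]]]].
have {}pm : compatible [set: edge T]%SET [set: edge T']%SET r r' by exact: pm.
have {}full : sublabels [set: edge T]%SET [set: edge T']%SET r r' by exact: full.
have {}full' : sublabels [set: edge T']%SET [set: edge T]%SET r' r by exact: full'.
have pm' := compatible_sym pm.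
pose M : {set prepairs T T'} := [set p : prepairs T T' | match p with
  | (inl v, inl w) => [&& bottom r v, bottom r' w & r v == r' w]
  | (inl v, inr s) => if s is Deletion then r v == None
                      else (r v != None) && ~~ bottom r v
  | (inr s, inl w) => if s is Deletion then r' w == None
                      else (r' w != None) && ~~ bottom r' w
  | (inr _, inr _) => false end]%SET.
have dl : deletedl M = unlabelled r by apply/setP=> v; rewrite !inE.
have dr : deletedr M = unlabelled r' by apply/setP=> v; rewrite !inE.
have gl : ghostedl M = non_bottom r by apply/setP=> v; rewrite !inE.
have gr : ghostedr M = non_bottom r' by apply/setP=> v; rewrite !inE.
have nb v : bottom r v -> r v != None by case/andP.
have nb' v : bottom r' v -> r' v != None by case/andP.
exists M.
  split.
  - by move=> s s'; rewrite inE.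
  - move=> v; case: (boolP (bottom r v)) => [bv|nbv].
      have [w0 _ rw0] := full v (finset.in_setT v) (elimN eqP (nb _ bv)).
      have [|w bw rw] := @bottom_exists T' L r' w0.
        by rewrite rw0; apply/eqP/nb.
      exists (inl w); split; first by rewrite inE bv bw rw rw0 eqxx.
      case=> [w'|[]]; rewrite inE.
      + case/and3P=> _ bw' /eqP rw'; congr inl.
        by apply: (bottom_uniq pm' bw bw'); rewrite rw rw0.
      + by move=> rv; have := nb _ bv; rewrite rv.
      + by rewrite bv andbF.
    case: (eqVneq (r v) None) => rv.
      exists (inr Deletion); split; first by rewrite inE rv.
      case=> [w'|[]]; rewrite inE ?rv ?eqxx //.
      by rewrite (negPf nbv).
    exists (inr Ghosting); split; first by rewrite inE rv nbv.
    by case=> [w'|[]]; rewrite inE ?(negPf nbv) ?(negPf rv).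
  - move=> w; case: (boolP (bottom r' w)) => [bw|nbw].
      have [v0 _ rv0] := full' w (finset.in_setT w) (elimN eqP (nb' _ bw)).
      have [|v bv rv] := @bottom_exists T L r v0.
        by rewrite rv0; apply/eqP/nb'.
      exists (inl v); split; first by rewrite inE bv bw rv rv0 eqxx.
      case=> [v'|[]]; rewrite inE.
      + case/and3P=> bv' _ /eqP rv'; congr inl.
        by apply: (bottom_uniq pm bv bv'); rewrite rv rv0.
      + by move=> rw; have := nb' _ bw; rewrite rw.
      + by rewrite bw andbF.
    case: (eqVneq (r' w) None) => rw.
      exists (inr Deletion); split; first by rewrite inE rw.
      case=> [v'|[]]; rewrite inE ?rw ?eqxx //.
      by rewrite (negPf nbw) andbF.
    exists (inr Ghosting); split; first by rewrite inE rw nbw.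
    by case=> [v'|[]]; rewrite inE ?(negPf nbw) ?(negPf rw) ?andbF.
  - move=> a c' b d; rewrite !inE => /and3P[ba bb /eqP rab] /and3P[bc bd /eqP rcd].
    case: (eqVneq (r a) (r c')) => [rac|/eqP nac].
      have <- : a = c' by exact: (bottom_uniq pm ba bc rac).
      have <- : b = d by apply: (bottom_uniq pm' bb bd); rewrite -rab -rcd.
      by split; rewrite (negPf (below_irr _)).
    suff -> : lower c' a = lower d b by [].
    apply: (consistent pm) => //; [exact/eqP/nb|exact/eqP/nb|exact/nesym].
  - move=> a; rewrite inE => ag; rewrite /prunedl dl.
    by apply: ghostable_degree2 (ghostable_blocks pm full) _; rewrite mem_enum inE.
  - move=> a; rewrite inE => ag; rewrite /prunedr dr.
    by apply: ghostable_degree2 (ghostable_blocks pm' full') _; rewrite mem_enum inE.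
apply: le_trans le_c.
rewrite /map_cost /reducedl /reducedr /prunedl /prunedr dl dr gl gr /mcost.
apply: lerD.
  rewrite le_eqVlt; apply/orP; left; apply/eqP.
  by rewrite /fiber_weight !norm_big; congr (_ + _); apply: eq_bigl => u;
    rewrite !inE.
(* each coupled pair contributes the term of its label *)
pose F (o : option L) := if o is Some a then
  mdist (fiber_weight (whole T) r (Some a)) (fiber_weight (whole T') r' (Some a))
  else 0.
have cP p : p \in coupled M -> [/\ bottom r p.1, bottom r' p.2 & r p.1 = r' p.2].
  by case: p => v w; rewrite !inE /= => /and3P[? ? /eqP].
rewrite (_ : \sum_(p in coupled M) _ = \sum_(p in coupled M) F (r p.1)).
  rewrite -(@big_imset _ _ _ _ _ (fun p => r p.1) _ F) /=.
    have -> : \sum_a mdist (fiber_weight (whole T) r (Some a))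
        (fiber_weight (whole T') r' (Some a)) = \sum_(o : option L) F o.
      by rewrite big_option /= add0r.
    rewrite [leRHS](bigID (mem [set r p.1 | p in coupled M]%SET)) /= lerDl.
    by apply: sumr_ge0 => -[a|] //= _; apply: mdist_ge0.
  move=> [v w] [v' w'] /cP[/= bv bw rvw] /cP[/= bv' bw' rvw'] rvv'.
  rewrite (bottom_uniq pm bv bv' rvv'); congr pair.
  by apply: (bottom_uniq pm' bw bw'); rewrite -rvw -rvw'.
apply: eq_bigr => p /cP[bv bw rvw].
rewrite (wt_bottom pm full bv) (wt_bottom pm' full' bw) -rvw /F.
by move: (nb _ bv); case: (r p.1).
Qed.

End LabellingToMapping.

(** * The edit distance is the minimal cost of a mapping *)
Theorem corollary2 (R : realType) (X : editableSpace R) :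
  (forall T T' : dendrogram X,
     [/\ finite_set (Mapp T T'),
         has_inf (path_costs T T'),
         exists2 M, Mapp T T' M & edit_dist T T' = map_cost M &
         forall M, Mapp T T' M -> edit_dist T T' <= map_cost M]) /\
  [/\ forall T T1 T' T1' : dendrogram X,
        dendro_iso T T1 -> dendro_iso T' T1' ->
        edit_dist T T' = edit_dist T1 T1',
      forall T T' : dendrogram X, 0 <= edit_dist T T',
      forall T : dendrogram X, edit_dist T T = 0,
      forall T T' : dendrogram X, edit_dist T T' = edit_dist T' T &
      forall T T' T'' : dendrogram X,
        edit_dist T T'' <= edit_dist T T' + edit_dist T' T''].
Proof.
have lb (T T' : dendrogram X) : has_lbound (path_costs T T').
  by exists 0 => c; apply: costs_ge0.
have dist_le (T T' : dendrogram X) c : path_costs T T' c -> edit_dist T T' <= c.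
  by move=> pc; apply: ge_inf.
have key (T T' : dendrogram X) :
    exists2 M, Mapp T T' M & edit_dist T T' = map_cost M.
  have [M0 mM0 _] : exists2 M : {set prepairs T T'}, mapping M & map_cost M <=
      \sum_(e : edge T) norm (weight e) + \sum_(e : edge T') norm (weight e).
    apply: labelling_mapping; apply: tighten.
    (* delete everything on both sides *)
    exists void, (fun=> None), (fun=> None); split; first by split.
    rewrite /mcost /fiber_weight !norm_big [X in _ + X]big1 => [|[]//].
    rewrite addr0 le_eqVlt; apply/orP; left; apply/eqP.
    by congr (_ + _); apply: eq_bigl => u; rewrite inE.
  have P0 : `[< mapping M0 >] by apply/asboolP.
  case: (@Order.TotalTheory.arg_minP _ R _ M0 (fun M => `[< mapping M >])
    (fun M => map_cost M) P0) => M /asboolP mM minM.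
  exists M => //; apply/eqP; rewrite eq_le; apply/andP; split.
    exact/dist_le/mapping_costs.
  apply: lb_le_inf; first by exists (map_cost M); apply: mapping_costs.
  move=> _ [g <-]; have [N mN] := labelling_mapping (path_labelling g).
  by apply: le_trans; apply/minM/asboolP.
have attained (T T' : dendrogram X) : path_costs T T' (edit_dist T T').
  by have [M mM ->] := key T T'; apply: mapping_costs.
have d0 (T T' : dendrogram X) : 0 <= edit_dist T T'.
  exact: costs_ge0 (attained T T').
have tri (T T' T'' : dendrogram X) :
    edit_dist T T'' <= edit_dist T T' + edit_dist T' T''.
  by apply: dist_le; apply: costs_trans (attained _ _) (attained _ _).
have iso0 (T T' : dendrogram X) : dendro_iso T T' -> edit_dist T T' = 0.
  move=> i; apply/eqP; rewrite eq_le d0 andbT.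
  exact/dist_le/costs_stop.
have sym (T T' : dendrogram X) : edit_dist T T' = edit_dist T' T.
  apply/eqP; rewrite eq_le.
  by apply/andP; split; apply: dist_le; apply: costs_sym.
split=> [T T'|].
  split; first exact: finite_finset.
  - by split; [exists (edit_dist T T')|].
  - exact: key.
  - by move=> M mM; apply/dist_le/mapping_costs.
split=> // [T T1 T' T1' i i'|T]; last exact/iso0/dendro_iso_refl.
have := tri T T1 T'; have := tri T1 T1' T'; have := tri T1 T T1'.
have := tri T T' T1'.
rewrite (iso0 _ _ i) (iso0 _ _ i') (sym T1 T) (iso0 _ _ i).
rewrite (sym T1' T') (iso0 _ _ i') => h1 h2 h3 h4.
lra.
Qed.
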